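(* Let $\varphi$ and $\psi$ be analytic self-maps of $D$ with $|\varphi|<1$ and $|\psi|<1$ a.e. on $\partial D$, and write $\varphi_t=t\varphi+(1-t)\psi$, $0\le t\le1$. If $\rho=\left|\frac{\varphi-\psi}{1-\overline{\varphi}\psi}\right|$ is essentially bounded away from one on $\partial D$, then there is a constant $B$ such that $$\|C_{\varphi_s}-C_{\varphi_r}\|_{\mathcal{B}(H^2)}\le B|s-r|,\qquad 0\le r<s\le1 .$$
   Context: $D$ is the open unit disk, $H^2$ the Hardy space on $D$, $C_\varphi f=f\circ\varphi$, and $\|\cdot\|_{\mathcal{B}(H^2)}$ is the operator norm on $H^2$. Boundary values on $\partial D$ are non-tangential limits. *)

(* Defs.v *)
From HB Require Import structures.
From mathcomp Require Import all_boot all_order all_algebra.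
From mathcomp Require Import complex.
From mathcomp Require Import all_classical all_reals all_analysis.

Set Implicit Arguments.
Unset Strict Implicit.
Unset Printing Implicit Defensive.

Import Order.TTheory GRing.Theory Num.Theory.
Import numFieldNormedType.Exports.

Local Open Scope classical_set_scope.
Local Open Scope ring_scope.
Local Open Scope complex_scope.

(* The regular alias [^o] is what carries the norm topology of [R[i]], seen as
   a normed space over itself. *)
Notation Cplx R := (R[i]^o)%type.

Section HardySpace.
Variable R : realType.
Implicit Types (f phi psi : Cplx R -> Cplx R) (z zeta w : Cplx R).

(* [`|z|] is itself an element of [R[i]]; [cabs z] is the same number in [R]. *)
Definition cabs z : R := complex.Re `|z|.

Definition disk : set (Cplx R) := [set z | cabs z < 1].

(* [derivable] is taken over the scalar field [R[i]]: complex differentiability. *)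
Definition analytic_on_disk f := forall z, disk z -> derivable f z 1.

Definition analytic_self_map phi :=
  analytic_on_disk phi /\ (forall z, disk z -> disk (phi z)).

Definition cis (theta : R) : Cplx R := cos theta +i* sin theta.

(* a.e. for the arc-length measure on the unit circle *)
Definition ae_circle (P : set (Cplx R)) :=
  {ae (@lebesgue_measure R),
    forall theta : R, 0 <= theta <= 2 * pi -> P (cis theta)}.

Definition stolz zeta (M : R) : set (Cplx R) :=
  [set z | disk z /\ cabs (z - zeta) < M * (1 - cabs z)].

Definition nontangential_limit f zeta w :=
  forall M : R, 1 < M -> f z @[z --> within (stolz zeta M) (nbhs zeta)] --> w.

Definition pseudo_hyperbolic z w : R := cabs ((z - w) / (1 - z^* * w)).

Local Open Scope ereal_scope.

Definition integral_mean2 f (r : R) : \bar R :=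
  ((2 * pi)^-1)%:E *
  \int[@lebesgue_measure R]_(theta in `[0%R, (2 * pi)%R])
    ((cabs (f (r%:C * cis theta)%R) ^+ 2)%:E).

Definition H2_norm f : \bar R :=
  ereal_sup [set integral_mean2 f r `^ 2^-1 | r in `]0%R, 1%R[].

Definition H2 f := analytic_on_disk f /\ H2_norm f < +oo.

Definition composition_operator phi f : Cplx R -> Cplx R := f \o phi.

Definition H2_operator_norm (T : (Cplx R -> Cplx R) -> Cplx R -> Cplx R) :
    \bar R :=
  ereal_sup [set H2_norm (T f) | f in [set f | H2 f /\ H2_norm f <= 1]].

End HardySpace.

Definition convex_path (R : realType) (phi psi : Cplx R -> Cplx R) (t : R) :
    Cplx R -> Cplx R :=
  fun z => t%:C * phi z + (1 - t)%:C * psi z.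

(* Main.v *)
(* On the boundary, the pseudo-hyperbolic bound says that |phi - psi|^2 is at
   most a constant times (1 - |phi_s|^2)(1 - |phi_r|^2).  For f holomorphic
   near the closed disk, subtracting two Cauchy formulas and applying
   Cauchy-Schwarz gives
     |f(a) - f(b)|^2 <= |a - b|^2 u(a) / ((1 - |a|^2)(1 - |b|^2)),
   where u is the Poisson integral of |f|^2.  With a = phi_s and b = phi_r,
   integrating over the circle bounds the norm of f o phi_s - f o phi_r by
   |s - r| times a constant times the mean of u o phi_s, which is u(phi_s(0))
   by harmonicity, hence at most a constant times the squared norm of f.

   The boundary inequality is only available as a limit along radii; this is
   handled by dominated convergence for the bounded dilations f(q z), with
   q -> 1 by Fatou's lemma.  Cauchy's formula is derived from Goursat's
   subdivision argument in logarithmic coordinates. *)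
Require Import Defs.
From HB Require Import structures.
From mathcomp Require Import all_boot all_order all_algebra.
From mathcomp Require Import complex.
From mathcomp Require Import all_classical all_reals all_analysis.
From mathcomp Require Import measurable_realfun ring lra.
Import Order.TTheory GRing.Theory Num.Theory.
Import numFieldNormedType.Exports.
Local Open Scope classical_set_scope.
Local Open Scope ring_scope.

Set Implicit Arguments.
Unset Strict Implicit.
Unset Printing Implicit Defensive.

Local Open Scope complex_scope.
Local Notation "x ^*" := (conjc x) : ring_scope.

(** * Modulus and topology of the complex numbers *)

Section ComplexModulus.
Variable R : realType.
Implicit Types z w : Cplx R.

(** The pseudo-hyperbolic bound controls only the product of the defects [1 - |a|^2] and
    [1 - |b|^2], whereas near one end of the segment both [phi_s] and [phi_r] see the same defect.
    The product bound is therefore split into two linear ones: each defect is at least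
    [(1 - delta^2)/2 * |a - b|]. Since [1 - |z|^2] is concave, this passes to every point of the
    segment, uniformly in the parameters, and gives the factor [2 / (1 - delta^2)] of the constant.
    The other factor, [1 / (1 - m)] with [m] the larger of [|phi(0)|] and [|psi(0)|], bounds the
    Poisson kernel at [phi_s(0)]. Boundary values of [f o phi_s] are never formed: integrals run
    over circles of radius below one, where the distortion may exceed its boundary bound. The excess
    tends to 0 almost everywhere but comes without a dominating function, so it is capped by
    [4 * C], a trivial bound for [|f(a) - f(b)|^2] when [|f|^2 <= C] on the circle. [C] depends on
    the dilation of [f]; it disappears because the radius tends to 1 before the dilation is removed.
    As means increase with the radius, a bound close to the circle is enough. *)

Lemma cabsE z : `|z| = (cabs z)%:C.
Proof. by rewrite /cabs normc_def. Qed.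

Lemma cabs_ge0 z : 0 <= cabs z.
Proof. by rewrite /cabs normc_def sqrtr_ge0. Qed.

Lemma sqr_cabs z : cabs z ^+ 2 = complex.Re z ^+ 2 + complex.Im z ^+ 2.
Proof. by rewrite /cabs normc_def sqr_sqrtr// addr_ge0 ?sqr_ge0. Qed.

Lemma cabsM z w : cabs (z * w) = cabs z * cabs w.
Proof. by apply: complexI; rewrite rmorphM -!cabsE normrM. Qed.

Lemma cabsD z w : cabs (z + w) <= cabs z + cabs w.
Proof. by rewrite -lecR rmorphD -!cabsE ler_normD. Qed.

Lemma cabsN z : cabs (- z) = cabs z.
Proof. by rewrite /cabs normrN. Qed.

Lemma cabsBC z w : cabs (z - w) = cabs (w - z).
Proof. by rewrite -cabsN opprB. Qed.

Lemma cabsB z w : cabs (z - w) <= cabs z + cabs w.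
Proof. by rewrite (le_trans (cabsD _ _))// cabsN. Qed.

Lemma cabs_eq0 z : (cabs z == 0) = (z == 0).
Proof. by rewrite -(inj_eq (@complexI R)) -cabsE normr_eq0. Qed.

Lemma cabs_gt0 z : (0 < cabs z) = (z != 0).
Proof. by rewrite lt_def cabs_eq0 cabs_ge0 andbT. Qed.

Lemma cabs0 : cabs (0 : Cplx R) = 0.
Proof. by apply/eqP; rewrite cabs_eq0. Qed.

Lemma cabsR (x : R) : cabs (x%:C : Cplx R) = `|x|.
Proof. by rewrite /cabs normc_def /= expr0n addr0 sqrtr_sqr. Qed.

Lemma cabs1 : cabs (1 : Cplx R) = 1.
Proof. by rewrite -[RHS]normr1 -cabsR. Qed.

Lemma cabsV z : cabs (z^-1 : Cplx R) = (cabs z)^-1.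
Proof. by apply: complexI; rewrite fmorphV -!cabsE normfV. Qed.

Lemma cabs_conj z : cabs (z^* : Cplx R) = cabs z.
Proof. by case: z => a b; rewrite /cabs !normc_def/= sqrrN. Qed.

Lemma cabs_cis (t : R) : cabs (cis t) = 1.
Proof. by rewrite /cabs normc_def/= cos2Dsin2 sqrtr1. Qed.

Lemma normr_Re_le z : `|complex.Re z| <= cabs z.
Proof.
rewrite -(@ler_pXn2r _ 2) ?nnegrE ?cabs_ge0//.
by rewrite sqr_cabs -normrX ger0_norm ?sqr_ge0// lerDl sqr_ge0.
Qed.

Lemma normr_Im_le z : `|complex.Im z| <= cabs z.
Proof.
rewrite -(@ler_pXn2r _ 2) ?nnegrE ?cabs_ge0//.
by rewrite sqr_cabs -normrX ger0_norm ?sqr_ge0// lerDr sqr_ge0.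
Qed.

Lemma Re_le_cabs z : complex.Re z <= cabs z.
Proof. exact: le_trans (ler_norm _) (normr_Re_le z). Qed.

Lemma cabs_i : cabs ('i : Cplx R) = 1.
Proof. by rewrite /cabs normc_def/= expr0n expr1n add0r sqrtr1. Qed.

Lemma cabs_ReIm z : cabs z <= `|complex.Re z| + `|complex.Im z|.
Proof.
have -> : z = ((complex.Re z)%:C : Cplx R) + 'i * (complex.Im z)%:C.
  exact: complexE.
rewrite (le_trans (cabsD _ _))//= !cabsM !cabsR cabs_i/=.
by rewrite mul1r !(mul0r, mul1r, mulr0, mulr1, addr0, add0r, subr0).
Qed.

Lemma mulc_conj z : z * z^* = ((cabs z ^+ 2)%:C : Cplx R).
Proof. by rewrite rmorphXn/= -cabsE; have -> := sqr_normc z. Qed.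

Lemma cis_neq0 (t : R) : cis t != 0.
Proof. by rewrite -cabs_gt0 cabs_cis. Qed.

Lemma conj_cis (t : R) : (cis t)^* = (cis t)^-1.
Proof.
apply: (mulfI (cis_neq0 t)).
by rewrite mulfV ?cis_neq0// mulc_conj cabs_cis expr1n.
Qed.

Lemma cisD (s t : R) : cis (s + t) = cis s * cis t.
Proof.
by apply/eqP; rewrite eq_complex/= cosD sinD eqxx/= [in eqbRHS]addrC eqxx.
Qed.

Lemma cis0 : cis (0 : R) = 1.
Proof. by rewrite /cis cos0 sin0. Qed.

Lemma cis2pi : cis (2 * pi : R) = 1.
Proof. by rewrite /cis mulr_natl cos2pi sin2pi. Qed.

End ComplexModulus.

Section ComplexTopology.
Variable R : realType.

(** The norm of [Cplx R] takes its values in [R[i]], and so do the epsilons of its limits. A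
    positive element of [R[i]] is real, which allows real epsilons throughout. *)
Lemma cvg_cabsP (T : Type) (F : set_system T) {FF : Filter F} (f : T -> Cplx R)
    (l : Cplx R) :
  (f x @[x --> F] --> l) <->
  (forall e : R, 0 < e -> \forall x \near F, cabs (f x - l) <= e).
Proof.
split=> [/cvgrPdist_le h e e0|h].
  have := h e%:C; rewrite ltcR => /(_ e0); apply: filterS => x.
  by rewrite cabsE lecR cabsBC.
apply/cvgrPdist_le => e e0.
have [k ek] : exists k, e = k%:C by apply/complex_realP; exact: gtr0_real.
move: e0; rewrite ek ltcR => k0; have := h _ k0; apply: filterS => x.
by rewrite cabsE lecR cabsBC.
Qed.

Lemma nbhs_cabs (z : Cplx R) (e : R) :
  0 < e -> \forall w \near z, cabs (w - z) <= e.
Proof.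
by move=> e0; have [+ _] := @cvg_cabsP _ (nbhs z) _ id z; apply => //; exact: cvg_id.
Qed.

Lemma continuous_Re : continuous (@complex.Re R : Cplx R -> R).
Proof.
move=> z; apply/(@cvgrPdist_le _ _ _ (nbhs z)) => e e0.
have := nbhs_cabs z e0; apply: filterS => w; apply: le_trans; rewrite -cabsN opprB.
by apply: le_trans (normr_Re_le _); case: z w => [? ?] [? ?].
Qed.

Lemma continuous_Im : continuous (@complex.Im R : Cplx R -> R).
Proof.
move=> z; apply/(@cvgrPdist_le _ _ _ (nbhs z)) => e e0.
have := nbhs_cabs z e0; apply: filterS => w; apply: le_trans; rewrite -cabsN opprB.
by apply: le_trans (normr_Im_le _); case: z w => [? ?] [? ?].
Qed.

Lemma continuous_cabs : continuous (@cabs R).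
Proof.
move=> z; apply/(@cvgrPdist_le _ _ _ (nbhs z)) => e e0.
have := nbhs_cabs z e0; apply: filterS => w; apply: le_trans.
rewrite ler_norml; apply/andP; split.
  rewrite lerNl opprB lerBlDr; apply: le_trans (cabsD _ _).
  by rewrite subrK.
rewrite lerBlDr cabsBC; apply: le_trans (cabsD _ _).
by rewrite subrK.
Qed.

Lemma continuous_conj : continuous (@conjc R : Cplx R -> Cplx R).
Proof.
move=> z; apply/(@cvg_cabsP _ (nbhs z)) => e e0.
have := nbhs_cabs z e0; apply: filterS => w; apply: le_trans.
have -> : (w^* - z^* : Cplx R) = (w - z)^* by rewrite rmorphB.
by rewrite cabs_conj.
Qed.

Lemma cvg_complex (T : Type) (F : set_system T) {FF : Filter F} (f g : T -> R)
    (a b : R) :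
  f x @[x --> F] --> a -> g x @[x --> F] --> b ->
  (f x +i* g x : Cplx R) @[x --> F] --> (a +i* b : Cplx R).
Proof.
move=> /cvgrPdist_le fa /cvgrPdist_le gb; apply/cvg_cabsP => e e0.
have e20 : 0 < e / 2 by rewrite divr_gt0.
near=> x; apply: le_trans (cabs_ReIm _) _.
rewrite [leRHS](splitr e) lerD//=; rewrite distrC; near: x.
  exact: fa.
exact: gb.
Unshelve. all: end_near. Qed.

Lemma continuous_cis : continuous (@cis R).
Proof. by move=> t; apply: cvg_complex; [exact: continuous_cos|exact: continuous_sin]. Qed.

Lemma continuous_real_complex : continuous (fun x : R => x%:C : Cplx R).
Proof. by move=> t; apply: cvg_complex; [exact: cvg_id|exact: cvg_cst]. Qed.

End ComplexTopology.

(** * Integration of continuous functions on a segment *)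

Section Integrals.
Variable R : realType.
Local Notation mu := (@lebesgue_measure R).
Implicit Types (a b : R) (g : R -> R) (F G : R -> Cplx R).

(** Continuity is two-sided even at the endpoints, so that composition needs no subspace
    topology. *)
Definition continuous_on a b (U : topologicalType) (g : R -> U) :=
  forall x, a <= x <= b -> {for x, continuous g}.

Definition rint a b g : R := \int[mu]_(x in `[a, b]) g x.

Definition cint a b F : Cplx R :=
  rint a b (fun x => complex.Re (F x)) +i* rint a b (fun x => complex.Im (F x)).

Lemma continuous_on_integrable a b g :
  continuous_on a b g -> mu.-integrable `[a, b] (EFin \o g).
Proof.
move=> cg; apply: continuous_compact_integrable; first exact: segment_compact.
apply: continuous_in_subspaceT => x; rewrite inE/= in_itv/= => xab.
exact: cg.
Qed.

Lemma continuous_on_comp a b (U V : topologicalType) (h : U -> V) (g : R -> U) :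
  (forall x, a <= x <= b -> {for g x, continuous h}) -> continuous_on a b g ->
  continuous_on a b (fun x => h (g x)).
Proof. by move=> ch cg x xab; apply: continuous_comp; [exact: cg|exact: ch]. Qed.

Lemma continuous_on_Re a b F : continuous_on a b F ->
  continuous_on a b (fun x => complex.Re (F x)).
Proof. by apply: continuous_on_comp => x _; exact: continuous_Re. Qed.

Lemma continuous_on_Im a b F : continuous_on a b F ->
  continuous_on a b (fun x => complex.Im (F x)).
Proof. by apply: continuous_on_comp => x _; exact: continuous_Im. Qed.

Lemma continuous_on_cabs a b F : continuous_on a b F ->
  continuous_on a b (fun x => cabs (F x)).
Proof. by apply: continuous_on_comp => x _; exact: continuous_cabs. Qed.

Lemma continuous_on_cst a b (U : topologicalType) (c : U) :
  continuous_on a b (fun=> c).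
Proof. by move=> x _; exact: cst_continuous. Qed.

Lemma continuous_onD (K : numFieldType) (V : normedModType K) a b (F G : R -> V) :
  continuous_on a b F -> continuous_on a b G ->
  continuous_on a b (fun x => F x + G x).
Proof. by move=> cF cG x xab; apply: cvgD; [exact: cF|exact: cG]. Qed.

Lemma continuous_onB (K : numFieldType) (V : normedModType K) a b (F G : R -> V) :
  continuous_on a b F -> continuous_on a b G ->
  continuous_on a b (fun x => F x - G x).
Proof. by move=> cF cG x xab; apply: cvgB; [exact: cF|exact: cG]. Qed.

Lemma continuous_onM (K : numFieldType) a b (F G : R -> K^o) :
  continuous_on a b F -> continuous_on a b G ->
  continuous_on a b (fun x => F x * G x : K^o).
Proof. by move=> cF cG x xab; apply: cvgM; [exact: cF|exact: cG]. Qed.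

Lemma continuous_onV (K : numFieldType) a b (F : R -> K^o) :
  (forall x, a <= x <= b -> F x != 0) -> continuous_on a b F ->
  continuous_on a b (fun x => (F x)^-1 : K^o).
Proof. by move=> F0 cF x xab; apply: cvgV; [exact: F0|exact: cF]. Qed.

Lemma continuous_onMc a b F G : continuous_on a b F -> continuous_on a b G ->
  continuous_on a b (fun x => F x * G x).
Proof. exact: (@continuous_onM R[i]). Qed.

Lemma continuous_onVc a b F :
  (forall x, a <= x <= b -> F x != 0) -> continuous_on a b F ->
  continuous_on a b (fun x => (F x)^-1).
Proof. exact: (@continuous_onV R[i]). Qed.

Lemma continuous_onBc a b F G : continuous_on a b F -> continuous_on a b G ->
  continuous_on a b (fun x => F x - G x).
Proof. exact: (@continuous_onB R[i] R[i]^o). Qed.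

Lemma continuous_onMr a b g1 g2 : continuous_on a b g1 -> continuous_on a b g2 ->
  continuous_on a b (fun x => g1 x * g2 x).
Proof. exact: (@continuous_onM R). Qed.

Lemma continuous_onVr a b g : (forall x, a <= x <= b -> g x != 0) ->
  continuous_on a b g -> continuous_on a b (fun x => (g x)^-1).
Proof. exact: (@continuous_onV R). Qed.

Lemma continuous_onDr a b g1 g2 : continuous_on a b g1 -> continuous_on a b g2 ->
  continuous_on a b (fun x => g1 x + g2 x).
Proof. exact: (@continuous_onD R R^o). Qed.

Lemma eq_rint a b g1 g2 : (forall x, a <= x <= b -> g1 x = g2 x) ->
  rint a b g1 = rint a b g2.
Proof. by move=> h; apply: eq_Rintegral => x; rewrite inE/= in_itv/=; exact: h. Qed.

Lemma eq_cint a b F G : (forall x, a <= x <= b -> F x = G x) ->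
  cint a b F = cint a b G.
Proof. by move=> h; congr Complex; apply: eq_rint => x /h ->. Qed.

Lemma rintD a b g1 g2 : continuous_on a b g1 -> continuous_on a b g2 ->
  rint a b (fun x => g1 x + g2 x) = rint a b g1 + rint a b g2.
Proof. by move=> ? ?; rewrite /rint RintegralD//; exact: continuous_on_integrable. Qed.

Lemma rintB a b g1 g2 : continuous_on a b g1 -> continuous_on a b g2 ->
  rint a b (fun x => g1 x - g2 x) = rint a b g1 - rint a b g2.
Proof. by move=> ? ?; rewrite /rint RintegralB//; exact: continuous_on_integrable. Qed.

Lemma rintZ a b c g : continuous_on a b g ->
  rint a b (fun x => c * g x) = c * rint a b g.
Proof. by move=> ?; rewrite /rint RintegralZl//; exact: continuous_on_integrable. Qed.

Lemma rint_cst a b c : a <= b -> rint a b (fun=> c) = c * (b - a).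
Proof.
move=> ab; rewrite /rint Rintegral_cst//= lebesgue_measure_itv/= lte_fin.
by case: ltP => //= ba; rewrite (@le_anti _ _ a b) ?ab//= subrr.
Qed.

Lemma le_rint a b g1 g2 : continuous_on a b g1 -> continuous_on a b g2 ->
  (forall x, a <= x <= b -> g1 x <= g2 x) -> rint a b g1 <= rint a b g2.
Proof.
move=> c1 c2 h; apply: le_Rintegral => //; try exact: continuous_on_integrable.
Qed.

Lemma rint_split a b c g : a <= b -> b <= c -> continuous_on a c g ->
  rint a c g = rint a b g + rint b c g.
Proof.
move=> ab bc /continuous_on_integrable ig.
have := Rintegral_itvB ig; move=> /(_ b); rewrite !bnd_simp => /(_ ab bc).
rewrite /rint Rintegral_itv_obnd_cbnd.
  by move=> <-; rewrite addrC subrK.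
apply: integrableS ig => //.
by apply: subset_itvr; rewrite bnd_simp.
Qed.

Lemma ReD (z w : Cplx R) : complex.Re (z + w) = complex.Re z + complex.Re w.
Proof. by case: z w => [? ?] [? ?]. Qed.

Lemma ImD (z w : Cplx R) : complex.Im (z + w) = complex.Im z + complex.Im w.
Proof. by case: z w => [? ?] [? ?]. Qed.

Lemma cintD a b F G : continuous_on a b F -> continuous_on a b G ->
  cint a b (fun x => F x + G x) = cint a b F + cint a b G.
Proof.
move=> cF cG; apply/eqP; rewrite eq_complex ReD ImD; apply/andP; split; apply/eqP.
- rewrite -rintD; [|exact: continuous_on_Re..].
  by apply: eq_rint => x _; rewrite ReD.
- rewrite -rintD; [|exact: continuous_on_Im..].
  by apply: eq_rint => x _; rewrite ImD.
Qed.

Lemma cintZ a b (c : Cplx R) F : continuous_on a b F ->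
  cint a b (fun x => c * F x) = c * cint a b F.
Proof.
move=> cF; case: c => c d.
have cR := continuous_on_Re cF; have cI := continuous_on_Im cF.
have cZ e g : continuous_on a b g -> continuous_on a b (fun x => e * g x).
  by move=> cg; apply: continuous_onMr => //; exact: continuous_on_cst.
apply/eqP; rewrite eq_complex/=; apply/andP; split; apply/eqP.
- rewrite -!rintZ// -rintB; [|exact: cZ..].
  by apply: eq_rint => x _; case: (F x).
- rewrite -!rintZ// -rintD; [|exact: cZ..].
  by apply: eq_rint => x _; case: (F x).
Qed.

Lemma cintB a b F G : continuous_on a b F -> continuous_on a b G ->
  cint a b (fun x => F x - G x) = cint a b F - cint a b G.
Proof.
move=> cF cG; have cN : continuous_on a b (fun x => -1 * G x : Cplx R).
  by apply: continuous_onMc; [exact: continuous_on_cst|exact: cG].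
have -> : cint a b (fun x => F x - G x) = cint a b (fun x => F x + -1 * G x).
  by apply: eq_cint => x _; rewrite mulN1r.
by rewrite (cintD cF cN) (cintZ (-1) cG) mulN1r.
Qed.

Lemma cint_cst a b (c : Cplx R) : a <= b -> cint a b (fun=> c) = (b - a)%:C * c.
Proof.
move=> ab; rewrite /cint !rint_cst//; case: c => c d.
by apply/eqP; rewrite eq_complex/= !mul0r subr0 addr0 ![(b - a) * _]mulrC !eqxx.
Qed.

Lemma cint_split a b c F : a <= b -> b <= c -> continuous_on a c F ->
  cint a c F = cint a b F + cint b c F.
Proof.
move=> ab bc cF.
apply/eqP; rewrite eq_complex ReD ImD; apply/andP; split; apply/eqP.
- by apply: rint_split => //; exact: continuous_on_Re.
- by apply: rint_split => //; exact: continuous_on_Im.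
Qed.

Lemma cint_conj a b F : continuous_on a b F ->
  cint a b (fun x => (F x)^*) = (cint a b F)^*.
Proof.
move=> cF; rewrite /cint/=; congr Complex.
- by apply: eq_rint => x _; case: (F x).
- rewrite -mulN1r -rintZ; last exact: continuous_on_Im.
  by apply: eq_rint => x _; case: (F x) => ? ?/=; rewrite mulN1r.
Qed.

Lemma Re_cint a b F : complex.Re (cint a b F) = rint a b (fun x => complex.Re (F x)).
Proof. by []. Qed.

(* Rotating the integral onto the positive axis turns its modulus into the
   integral of a real part. *)
Lemma cabs_cint_le a b F : continuous_on a b F ->
  cabs (cint a b F) <= rint a b (fun x => cabs (F x)).
Proof.
move=> cF; set I := cint a b F.
have [->|I0] := eqVneq I 0.
  rewrite cabs0; apply: Rintegral_ge0 => x _; exact: cabs_ge0.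
have cI0 : 0 < cabs I by rewrite cabs_gt0.
rewrite -(ler_pM2l cI0) -expr2 -rintZ; last exact: continuous_on_cabs.
have -> : cabs I ^+ 2 = complex.Re (I^* * I : Cplx R) by rewrite mulrC mulc_conj.
rewrite -cintZ// Re_cint; apply: le_rint.
- apply: continuous_on_Re; apply: continuous_onMc; last exact: cF.
  exact: continuous_on_cst.
- apply: continuous_onMr; first exact: continuous_on_cst.
  exact: continuous_on_cabs.
- by move=> x _; apply: le_trans (Re_le_cabs _) _; rewrite cabsM cabs_conj.
Qed.

Lemma cabs_cint_bound a b F (M : R) : a <= b -> continuous_on a b F ->
  (forall x, a <= x <= b -> cabs (F x) <= M) -> cabs (cint a b F) <= M * (b - a).
Proof.
move=> ab cF h; apply: le_trans (cabs_cint_le cF) _.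
rewrite -rint_cst//; apply: le_rint => //; first exact: continuous_on_cabs.
exact: continuous_on_cst.
Qed.

End Integrals.

(** * Goursat's lemma *)

Section Subdivision.
Variable R : realType.
Variables (Phi : R -> R -> R -> R -> Cplx R) (x1 x2 y1 y2 : R).
Hypothesis x12 : x1 <= x2.
Hypothesis y12 : y1 <= y2.
Hypothesis PhiX : forall a b c u v, x1 <= a -> a <= b -> b <= c -> c <= x2 ->
  y1 <= u -> u <= v -> v <= y2 -> Phi a c u v = Phi a b u v + Phi b c u v.
Hypothesis PhiY : forall a b u v w, x1 <= a -> a <= b -> b <= x2 ->
  y1 <= u -> u <= v -> v <= w -> w <= y2 -> Phi a b u w = Phi a b u v + Phi a b v w.
Hypothesis Phi_small : forall p q, x1 <= p <= x2 -> y1 <= q <= y2 ->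
  forall e, 0 < e -> exists2 d, 0 < d &
  forall a b u v, x1 <= a -> a <= p <= b -> b <= x2 -> y1 <= u -> u <= q <= v -> v <= y2 ->
    b - a < d -> v - u < d -> cabs (Phi a b u v) <= e * ((b - a) + (v - u)) ^+ 2.

Let h n := (x2 - x1) / 2 ^+ n.
Let k n := (y2 - y1) / 2 ^+ n.
Let M := cabs (Phi x1 x2 y1 y2).

(** [s] is the lower left corner of a rectangle reached after [n] bisections of both sides, which
    still carries its share of [M]. *)
Let big n (s : R * R) :=
  [/\ x1 <= s.1, s.1 + h n <= x2, y1 <= s.2, s.2 + k n <= y2 &
   M / 4 ^+ n <= cabs (Phi s.1 (s.1 + h n) s.2 (s.2 + k n))].

Let finer n (s t : R * R) :=
  [/\ s.1 <= t.1, t.1 + h n.+1 <= s.1 + h n, s.2 <= t.2 & t.2 + k n.+1 <= s.2 + k n].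

Let h_ge0 n : 0 <= h n. Proof. by rewrite divr_ge0 ?subr_ge0 ?exprn_ge0. Qed.
Let k_ge0 n : 0 <= k n. Proof. by rewrite divr_ge0 ?subr_ge0 ?exprn_ge0. Qed.
Let hS n : h n = h n.+1 + h n.+1.
Proof. by rewrite /h exprS invfM; field; rewrite expf_neq0. Qed.
Let kS n : k n = k n.+1 + k n.+1.
Proof. by rewrite /k exprS invfM; field; rewrite expf_neq0. Qed.

(** If all four quarters fell below [M / 4 ^+ n.+1], the triangle inequality would put their sum
    strictly below [M / 4 ^+ n]. *)
Let quarter n s : big n s -> exists t, big n.+1 t /\ finer n s t.
Proof.
case: s => a u [/= xa ax yu uy MPhi].
have h0 := h_ge0 n.+1; have k0 := k_ge0 n.+1.
rewrite hS in ax MPhi; rewrite kS in uy MPhi.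
set A := Phi a (a + h n.+1) u (u + k n.+1).
set B := Phi (a + h n.+1) (a + h n.+1 + h n.+1) u (u + k n.+1).
set C := Phi a (a + h n.+1) (u + k n.+1) (u + k n.+1 + k n.+1).
set D := Phi (a + h n.+1) (a + h n.+1 + h n.+1) (u + k n.+1) (u + k n.+1 + k n.+1).
have E : Phi a (a + (h n.+1 + h n.+1)) u (u + (k n.+1 + k n.+1)) = A + B + (C + D).
  rewrite !(addrA a) !(addrA u).
  have -> : Phi a (a + h n.+1 + h n.+1) u (u + k n.+1 + k n.+1) =
      Phi a (a + h n.+1 + h n.+1) u (u + k n.+1) +
      Phi a (a + h n.+1 + h n.+1) (u + k n.+1) (u + k n.+1 + k n.+1).
    by apply: PhiY; lra.
  by congr (_ + _); apply: PhiX; lra.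
rewrite E in MPhi.
pose m := M / 4 ^+ n.+1.
have Em : M / 4 ^+ n = m + m + (m + m).
  by rewrite /m exprS invfM; field; rewrite expf_neq0.
have tri := cabsD (A + B) (C + D); have trl := cabsD A B; have trr := cabsD C D.
have [mA|Am] := lerP m (cabs A).
  by exists (a, u); split; split => /=; rewrite ?(hS n) ?(kS n) -/m//; lra.
have [mB|Bm] := lerP m (cabs B).
  by exists (a + h n.+1, u); split; split => /=; rewrite ?(hS n) ?(kS n) -/m//; lra.
have [mC|Cm] := lerP m (cabs C).
  by exists (a, u + k n.+1); split; split => /=; rewrite ?(hS n) ?(kS n) -/m//; lra.
have [mD|Dm] := lerP m (cabs D).
  by exists (a + h n.+1, u + k n.+1); split; split => /=; rewrite ?(hS n) ?(kS n) -/m//; lra.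
lra.
Qed.

Let exp2_small (H d : R) : 0 < d -> exists n, H / 2 ^+ n < d.
Proof.
move=> d0; exists (Num.bound `|d^-1 * H|).
rewrite ltr_pdivrMr ?exprn_gt0// -ltr_pdivrMl//.
apply: le_lt_trans (ler_norm _) _.
apply: lt_trans (archi_boundP (normr_ge0 _)) _.
rewrite -natrX ltr_nat; exact: ltn_expl.
Qed.

(** Goursat's argument uses of the contour integral only additivity and smallness at each point.
    After [n] bisections some rectangle carries at least [M / 4 ^+ n], while smallness at the common
    point allows at most [e * L ^+ 2 / 4 ^+ n]; the powers of 4 cancel. *)
Lemma subdivision_eq0 : Phi x1 x2 y1 y2 = 0.
Proof.
apply/eqP; rewrite -cabs_eq0 -/M; apply/negP => /negP M0.
have M_gt0 : 0 < M by rewrite lt_def M0 cabs_ge0.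
(* Choice asks for a total relation, so [big] stays a premise and a corner violating it is sent to
   itself. *)
have [st step] : {st : nat * (R * R) -> R * R &
    forall t, big t.1 t.2 -> big t.1.+1 (st t) /\ finer t.1 t.2 (st t)}.
  apply: (@choice _ _ (fun t st => big t.1 t.2 -> big t.1.+1 st /\ finer t.1 t.2 st)).
  move=> -[n s] /=.
  have [/quarter[t ?]|nb] := pselect (big n s); first by exists t.
  by exists s.
pose s := fix s n := if n is m.+1 then st (m, s m) else (x1, y1).
have bs n : big n (s n).
  elim: n => [|n ih]; last by have [] := step (n, s n) ih.
  rewrite /big/= /h /k expr0 !divr1; split; try lra.
  by rewrite (addrC x1) (addrC y1) !subrK.
have fs n : finer n (s n) (s n.+1) by have [] := step (n, s n) (bs n).
have mono m n : [/\ (s m).1 <= (s (m + n)%N).1, (s (m + n)%N).1 + h (m + n) <= (s m).1 + h m,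
    (s m).2 <= (s (m + n)%N).2 & (s (m + n)%N).2 + k (m + n) <= (s m).2 + k m].
  elim: n => [|n [i1 i2 i3 i4]]; first by rewrite addn0.
  rewrite addnS; have [j1 j2 j3 j4] := fs (m + n)%N; split; lra.
(* Every left end lies below every right end, whatever the two generations; hence the supremum of
   the left ends belongs to all the intervals. *)
have cross m n : (s n).1 <= (s m).1 + h m /\ (s n).2 <= (s m).2 + k m.
  have [mn|/ltnW nm] := leqP m n.
    have [] := mono m (n - m)%N; rewrite subnKC// => _ + _ +.
    by have := h_ge0 n; have := k_ge0 n; split; lra.
  have [] := mono n (m - n)%N; rewrite subnKC// => + _ + _.
  by have := h_ge0 m; have := k_ge0 m; split; lra.
pose p := sup (range (fun n => (s n).1)); pose q := sup (range (fun n => (s n).2)).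
have sp n : (s n).1 <= p <= (s n).1 + h n.
  apply/andP; split.
    apply: ub_le_sup; last by exists n.
    by exists ((s 0%N).1 + h 0%N) => _ [m _ <-]; case: (cross 0%N m).
  apply: ge_sup; first by exists (s 0%N).1; exists 0%N.
  by move=> _ [m _ <-]; case: (cross n m).
have sq n : (s n).2 <= q <= (s n).2 + k n.
  apply/andP; split.
    apply: ub_le_sup; last by exists n.
    by exists ((s 0%N).2 + k 0%N) => _ [m _ <-]; case: (cross 0%N m).
  apply: ge_sup; first by exists (s 0%N).2; exists 0%N.
  by move=> _ [m _ <-]; case: (cross n m).
pose L := (x2 - x1) + (y2 - y1).
have L0 : 0 <= L by rewrite addr_ge0// subr_ge0.
(* Chosen so that [e * L ^+ 2 < M]; the added 1 covers a degenerate rectangle with [L = 0]. *)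
have e0 : 0 < M / (2 * (L ^+ 2 + 1)).
  by rewrite divr_gt0// mulr_gt0// ltr_wpDl// sqr_ge0.
have [||d d0 small] := @Phi_small p q _ _ _ e0.
- by have := sp 0%N; rewrite /= /h expr0 divr1; lra.
- by have := sq 0%N; rewrite /= /k expr0 divr1; lra.
have [n nL] := exp2_small L d0.
have LE : L / 2 ^+ n = h n + k n by rewrite /L /h /k mulrDl.
rewrite LE in nL.
have [b1 b2 b3 b4 b5] := bs n.
have := h_ge0 n => hn; have := k_ge0 n => kn.
have H := small _ _ _ _ b1 (sp n) b2 b3 (sq n) b4.
have Eh : (s n).1 + h n - (s n).1 = h n by rewrite addrC addKr.
have Ek : (s n).2 + k n - (s n).2 = k n by rewrite addrC addKr.
rewrite Eh Ek -LE expr_div_n in H.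
have {}H : M / 4 ^+ n <= M / (2 * (L ^+ 2 + 1)) * (L ^+ 2 / (2 ^+ n) ^+ 2).
  by apply: le_trans b5 (H _ _); lra.
have E4 : (2 ^+ n) ^+ 2 = 4 ^+ n :> R by rewrite exprAC -natrX.
rewrite E4 mulrA ler_pM2r ?invr_gt0 ?exprn_gt0// in H.
have L1 : 0 < 2 * (L ^+ 2 + 1) by rewrite mulr_gt0// ltr_wpDl// sqr_ge0.
have : M < M; last by rewrite ltxx.
apply: le_lt_trans H _; rewrite mulrAC ltr_pdivrMr// ltr_pM2l//.
have := sqr_ge0 L; lra.
Qed.

End Subdivision.

(** * Cauchy's theorem for a rectangle *)

Section Goursat.
Variable R : realType.
Variables (F : R -> R -> Cplx R) (x1 x2 y1 y2 : R).
Hypothesis x12 : x1 <= x2.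
Hypothesis y12 : y1 <= y2.
Hypothesis cFx : forall y, y1 <= y <= y2 -> continuous_on x1 x2 (F ^~ y).
Hypothesis cFy : forall x, x1 <= x <= x2 -> continuous_on y1 y2 (F x).
Hypothesis dF : forall p q, x1 <= p <= x2 -> y1 <= q <= y2 ->
  exists c : Cplx R, forall e, 0 < e -> exists2 d, 0 < d &
  forall x y, `|x - p| < d -> `|y - q| < d ->
  cabs (F x y - F p q - c * ((x - p) +i* (y - q))) <= e * (`|x - p| + `|y - q|).

(** The counterclockwise contour integral over the boundary of [[a, b] x [u, v]], with opposite
    sides paired. *)
Let Phi a b u v : Cplx R := cint a b (fun x => F x u - F x v) +
  'i * cint u v (fun y => F b y - F a y).

Lemma continuous_onS a b a' b' (U : topologicalType) (g : R -> U) :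
  a <= a' -> b' <= b -> continuous_on a b g -> continuous_on a' b' g.
Proof. by move=> aa bb cg x /andP[ax xb]; apply: cg; lra. Qed.

Let cx a b u v : x1 <= a -> b <= x2 -> y1 <= u <= y2 -> y1 <= v <= y2 ->
  continuous_on a b (fun x => F x u - F x v).
Proof.
move=> xa bx hu hv; apply: continuous_onBc.
  exact: continuous_onS (cFx hu).
exact: continuous_onS (cFx hv).
Qed.

Let cy a b u v : y1 <= a -> b <= y2 -> x1 <= u <= x2 -> x1 <= v <= x2 ->
  continuous_on a b (fun y => F u y - F v y).
Proof.
move=> xa bx hu hv; apply: continuous_onBc.
  exact: continuous_onS (cFy hu).
exact: continuous_onS (cFy hv).
Qed.

Lemma goursat_rectangle :
  cint x1 x2 (fun x => F x y1 - F x y2) + 'i * cint y1 y2 (fun y => F x2 y - F x1 y) = 0.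
Proof.
apply: (@subdivision_eq0 R Phi x1 x2 y1 y2) => //.
- move=> a b c u v xa ab bc cx2 yu uv vy; rewrite /Phi.
  have -> : cint a c (fun x => F x u - F x v) =
      cint a b (fun x => F x u - F x v) + cint b c (fun x => F x u - F x v).
    by apply: cint_split => //; apply: cx; lra.
  have -> : cint u v (fun y => F c y - F a y) =
      cint u v (fun y => F b y - F a y) + cint u v (fun y => F c y - F b y).
    rewrite -cintD; [|by apply: cy; lra..].
    by apply: eq_cint => y _; rewrite [RHS]addrC addrA subrK.
  by rewrite mulrDr addrACA.
- move=> a b u v w xa ab bx yu uv vw wy; rewrite /Phi.
  have -> : cint u w (fun y => F b y - F a y) =
      cint u v (fun y => F b y - F a y) + cint v w (fun y => F b y - F a y).
    by apply: cint_split => //; apply: cy; lra.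
  have -> : cint a b (fun x => F x u - F x w) =
      cint a b (fun x => F x u - F x v) + cint a b (fun x => F x v - F x w).
    rewrite -cintD; [|by apply: cx; lra..].
    by apply: eq_cint => y _; rewrite addrA subrK.
  by rewrite mulrDr addrACA.
move=> p q hp hq e e0; have [c hc] := dF hp hq.
have e40 : 0 < e / 2 by rewrite divr_gt0.
have [d d0 hd] := hc _ e40; exists d => // a b u v xa pab bx yu quv vy bad vud.
pose D := (b - a) + (v - u).
have D0 : 0 <= D by rewrite /D; lra.
have bound x y : a <= x <= b -> u <= y <= v ->
    cabs (F x y - F p q - c * ((x - p) +i* (y - q))) <= e / 2 * D.
  move=> hx hy; apply: (le_trans (hd _ _ _ _)).
  - by rewrite ltr_norml; lra.
  - by rewrite ltr_norml; lra.
  by rewrite ler_pM2l// lerD// ler_norml; lra.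
(* Between opposite sides the constant [F p q] drops out and the linear part of the expansion
   differs by the constants [c1] and [c2], whose contributions to the contour integral cancel. Each
   of the two sides adds an error [e / 2 * D]. *)
pose c1 : Cplx R := c * (0 +i* (u - v)).
pose c2 : Cplx R := c * ((b - a) +i* 0).
have ab : a <= b by lra.
have uv : u <= v by lra.
have uy1 : y1 <= u <= y2 by lra.
have vy1 : y1 <= v <= y2 by lra.
have ax1 : x1 <= a <= x2 by lra.
have bx1 : x1 <= b <= x2 by lra.
have key (z1 z2 z0 w1 w2 : Cplx R) : z1 - z2 - c * (w1 - w2) =
    (z1 - z0 - c * w1) - (z2 - z0 - c * w2).
  by ring.
have E1 : cabs (cint a b (fun x => F x u - F x v - c1)) <= e * D * (b - a).
  apply: cabs_cint_bound => //.
    apply: continuous_onBc; last exact: continuous_on_cst.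
    exact: cx.
  move=> x hx; rewrite /c1.
  have -> : (0 +i* (u - v) : Cplx R) = ((x - p) +i* (u - q)) - ((x - p) +i* (v - q)).
    by apply/eqP; rewrite eq_complex/=; apply/andP; split; apply/eqP; ring.
  rewrite (key _ _ (F p q)); apply: (le_trans (cabsB _ _)).
  have B1 := @bound x u hx; have B2 := @bound x v hx; move: B1 B2.
  by rewrite !lexx uv => /(_ isT) B1 /(_ isT) B2; lra.
have E2 : cabs (cint u v (fun y => F b y - F a y - c2)) <= e * D * (v - u).
  apply: cabs_cint_bound => //.
    apply: continuous_onBc; last exact: continuous_on_cst.
    exact: cy.
  move=> y hy; rewrite /c2.
  have -> : ((b - a) +i* 0 : Cplx R) = ((b - p) +i* (y - q)) - ((a - p) +i* (y - q)).
    by apply/eqP; rewrite eq_complex/=; apply/andP; split; apply/eqP; ring.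
  rewrite (key _ _ (F p q)); apply: (le_trans (cabsB _ _)).
  have B1 := @bound b y; have B2 := @bound a y; move: B1 B2.
  by rewrite !lexx ab => /(_ isT hy) B1 /(_ isT hy) B2; lra.
have -> : Phi a b u v = cint a b (fun x => F x u - F x v - c1) +
    'i * cint u v (fun y => F b y - F a y - c2).
  have -> : cint a b (fun x => F x u - F x v - c1) =
      cint a b (fun x => F x u - F x v) - cint a b (fun=> c1).
    by have cF := cx xa bx uy1 vy1; exact: cintB cF (@continuous_on_cst R a b (Cplx R) c1).
  have -> : cint u v (fun y => F b y - F a y - c2) =
      cint u v (fun y => F b y - F a y) - cint u v (fun=> c2).
    by have cF := cy yu vy bx1 ax1; exact: cintB cF (@continuous_on_cst R u v (Cplx R) c2).
  rewrite !cint_cst// mulrBr addrACA -opprD.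
  suff -> : (b - a)%:C * c1 + 'i * ((v - u)%:C * c2) = 0 :> Cplx R.
    by rewrite subr0.
  rewrite /c1 /c2 !mulrA ![_ * c]mulrC -!mulrA -mulrDr.
  suff -> : (b - a)%:C * (0 +i* (u - v)) + 'i * ((v - u)%:C * ((b - a) +i* 0)) = 0 :> Cplx R.
    by rewrite mulr0.
  by apply/eqP; rewrite eq_complex/=; apply/andP; split; apply/eqP; ring.
apply: (le_trans (cabsD _ _)); rewrite cabsM cabs_i mul1r; apply: (le_trans (lerD E1 E2)).
by rewrite -mulrDr -/D -mulrA -expr2.
Qed.

End Goursat.

(** * Circle integrals of holomorphic functions *)

Section ComplexDerivative.
Variable R : realType.
Implicit Types (f g : Cplx R -> Cplx R) (z c : Cplx R).

Lemma derivable_cM f g z : derivable f z 1 -> derivable g z 1 ->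
  derivable (fun x => f x * g x : Cplx R) z 1.
Proof. exact: (@derivableM R[i] R[i]^o). Qed.

Lemma derivable_cD f g z : derivable f z 1 -> derivable g z 1 ->
  derivable (fun x => f x + g x : Cplx R) z 1.
Proof. exact: (@derivableD R[i] R[i]^o R[i]^o). Qed.

Lemma derivable_cB f g z : derivable f z 1 -> derivable g z 1 ->
  derivable (fun x => f x - g x : Cplx R) z 1.
Proof. exact: (@derivableB R[i] R[i]^o R[i]^o). Qed.

Lemma derivable_cV f z : f z != 0 -> derivable f z 1 ->
  derivable (fun x => (f x)^-1 : Cplx R) z 1.
Proof. exact: (@derivableV R[i] R[i]^o). Qed.

Lemma derivable_c_cst c z : derivable (fun=> c : Cplx R) z 1.
Proof. exact: (@derivable_cst R[i] R[i]^o R[i]^o). Qed.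

Lemma derivable_c_id z : derivable (fun x : Cplx R => x) z 1.
Proof. exact: (@derivable_id R[i] R[i]^o). Qed.

Lemma derivable_c_comp f g z : derivable f z 1 -> derivable g (f z) 1 ->
  derivable (fun x => g (f x)) z 1.
Proof.
move=> /(@derivable1_diffP R[i] R[i]^o) df /(@derivable1_diffP R[i] R[i]^o) dg.
have [_] := @derivable1_diffP R[i] R[i]^o (g \o f) z; apply.
exact: (@differentiable_comp R[i] R[i]^o R[i]^o R[i]^o f g z df dg).
Qed.

Lemma derivable_c_continuous f z : derivable f z 1 -> {for z, continuous f}.
Proof.
by move=> /(@derivable1_diffP R[i] R[i]^o); exact: differentiable_continuous.
Qed.

Lemma derivable_quotient f z : derivable f z 1 -> exists c, forall e, 0 < e ->
  exists2 d : R, 0 < d & forall x, x != z -> cabs (x - z) < d ->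
  cabs ((f x - f z) / (x - z) - c) <= e.
Proof.
move=> /cvg_ex[c /= fc]; exists c => e e0.
have e0' : 0 < (e%:C : R[i]) by rewrite ltcR.
have [+ _] := @cvgrPdist_le _ _ _ (0 : R[i]^o)^' _
  (fun h : R[i]^o => h^-1 *: (f (h *: 1 + z) - f z)) c.
move=> /(_ fc _ e0')[k /= k0 hk].
have [d kd] : exists d, k = d%:C by apply/complex_realP; exact: gtr0_real.
move: k0 hk; rewrite kd ltcR => d0 hk; exists d => // x xz xd.
have := hk (x - z); rewrite /ball_/= sub0r normrN subr_eq0 xz cabsE ltcR.
move=> /(_ xd isT); rewrite /GRing.scale/= mulr1 subrK cabsE lecR cabsBC.
by rewrite [_^-1 * _]mulrC.
Qed.

Lemma derivable_expansion f z : derivable f z 1 -> exists c, forall e, 0 < e ->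
  exists2 d : R, 0 < d & forall x, cabs (x - z) < d ->
  cabs (f x - f z - c * (x - z)) <= e * cabs (x - z).
Proof.
move=> /derivable_quotient[c hc]; exists c => e /hc[d d0 hd]; exists d => // x xd.
have [->|xz] := eqVneq x z; first by rewrite !subrr mulr0 subrr cabs0 mulr0.
have xz0 : x - z != 0 by rewrite subr_eq0.
have -> : f x - f z - c * (x - z) = ((f x - f z) / (x - z) - c) * (x - z).
  by rewrite mulrBl divfK.
by rewrite cabsM ler_wpM2r ?cabs_ge0// hd.
Qed.

End ComplexDerivative.

(** * Exponential coordinates and integrals over concentric circles *)

Section ExpCis.
Variable R : realType.

Lemma is_derive_expansion (f : R -> R) (x df : R) : is_derive x 1 f df ->
  forall e, 0 < e -> \forall h \near 0, `|f (h + x) - f x - df * h| <= e * `|h|.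
Proof.
move=> [fx <-] e e0.
have [+ _] := @cvgrPdist_le _ _ _ (0 : R)^' _
  (fun h : R => h^-1 *: (f (h *: 1 + x) - f x)) ('D_1 f x).
move=> /(_ fx _ e0)[k /= k0 hk]; exists k => // h /= hk'.
have [->|h0] := eqVneq h 0; first by rewrite add0r subrr mulr0 subrr normr0 mulr0.
have := hk h hk' h0; rewrite /GRing.scale/= mulr1 => H.
have -> : f (h + x) - f x - 'D_1 f x * h = - (('D_1 f x - h^-1 * (f (h + x) - f x)) * h).
  by field.
by rewrite normrN normrM ler_wpM2r.
Qed.

(** The exponential of [x + iy]: it wraps a rectangle of height [2 * pi] around an annulus. *)
Definition expcis (x y : R) : Cplx R := (expR x)%:C * cis y.

Lemma expcisD a b x y : expcis (a + x) (b + y) = expcis a b * expcis x y.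
Proof. by rewrite /expcis expRD cisD rmorphM/= mulrACA. Qed.

Lemma expcis_expansion0 (e : R) : 0 < e ->
  exists2 d, 0 < d & forall x y, `|x| < d -> `|y| < d ->
  cabs (expcis x y - 1 - (x +i* y)) <= e * (`|x| + `|y|).
Proof.
(* The coefficient of [|y|] in the final error is 5: two [e'] in the real part and three in the
   imaginary part, with [expR x <= 2] near 0. *)
move=> e0; pose e' := e / 5; have e'0 : 0 < e' by rewrite divr_gt0.
have H1 := is_derive_expansion (is_derive_expR (0 : R)) e'0.
have H2 := is_derive_expansion (is_derive_cos (0 : R)) e'0.
have H3 := is_derive_expansion (is_derive_sin (0 : R)) e'0.
have H4 : \forall h \near (0 : R), `|expR h - 1| <= Num.min e' 1.
  have : expR x @[x --> (0 : R)] --> expR 0 by exact: continuous_expR.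
  rewrite expR0 => /cvgrPdist_le/(_ (Num.min e' 1)).
  by rewrite lt_min e'0 ltr01 => /(_ isT); apply: filterS => h; rewrite distrC.
have [d d0 hd] := filterI (filterI H1 H2) (filterI H3 H4).
exists d => // x y xd yd.
have [|[X1 _] [_]] := hd x; first by rewrite /= sub0r normrN.
rewrite le_min => /andP[X4 X5].
have [|[_ Y2] [Y3 _]] := hd y; first by rewrite /= sub0r normrN.
move: X1 Y2 Y3; rewrite !addr0 expR0 cos0 sin0 oppr0 mul0r !subr0 !addr0 !mul1r => X1 Y2 Y3.
have X6 : expR x <= 2 by move: X5; rewrite ler_norml; lra.
have X7 := expR_ge0 x.
apply: le_trans (cabs_ReIm _) _ => /=; rewrite mul0r subr0 mul0r addr0 subr0.
have T1 : `|expR x * cos y - 1 - x| <= e' * `|x| + 2 * (e' * `|y|).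
  have -> : expR x * cos y - 1 - x = (expR x - 1 - x) + expR x * (cos y - 1) by ring.
  apply: le_trans (ler_normD _ _) _; rewrite lerD// normrM ger0_norm//.
  by rewrite ler_pM.
have T2 : `|expR x * sin y - y| <= 2 * (e' * `|y|) + e' * `|y|.
  have -> : expR x * sin y - y = expR x * (sin y - y) + (expR x - 1) * y by ring.
  apply: le_trans (ler_normD _ _) _; rewrite !normrM (ger0_norm X7).
  by apply: lerD; [rewrite ler_pM|rewrite ler_wpM2r].
have xe : 0 <= e' * `|x| by rewrite mulr_ge0// ltW.
have ye : 0 <= e' * `|y| by rewrite mulr_ge0// ltW.
have Ee : e = 5 * e' by rewrite /e'; field.
rewrite Ee -mulrA mulrDr; apply: le_trans (lerD T1 T2) _.
by move: xe ye; generalize (e' * `|x|) (e' * `|y|) => u v; lra.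
Qed.

Lemma cabs_expcis x y : cabs (expcis x y) = expR x.
Proof. by rewrite cabsM cabs_cis mulr1 cabsR ger0_norm ?expR_ge0. Qed.

Lemma expcis_expansion p q (e : R) : 0 < e -> exists2 d, 0 < d &
  forall x y, `|x - p| < d -> `|y - q| < d ->
  cabs (expcis x y - expcis p q - expcis p q * ((x - p) +i* (y - q))) <=
  e * (`|x - p| + `|y - q|).
Proof.
move=> e0; have P0 := expR_gt0 p.
have [|d d0 hd] := @expcis_expansion0 (e / expR p); first by rewrite divr_gt0.
exists d => // x y xd yd.
have Exy : expcis x y = expcis p q * expcis (x - p) (y - q).
  by rewrite -expcisD ![_ + (_ - _)]addrC !subrK.
have -> : expcis x y - expcis p q - expcis p q * ((x - p) +i* (y - q)) =
    expcis p q * (expcis (x - p) (y - q) - 1 - ((x - p) +i* (y - q))).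
  by rewrite Exy !mulrBr mulr1.
rewrite cabsM cabs_expcis -ler_pdivlMl// mulrA [_^-1 * _]mulrC.
exact: hd.
Qed.

Lemma continuous_on_realc a b (g : R -> R) : continuous_on a b g ->
  continuous_on a b (fun x => (g x)%:C : Cplx R).
Proof. by apply: continuous_on_comp => x _; exact: continuous_real_complex. Qed.

Lemma continuous_on_expcis1 a b y : continuous_on a b (expcis ^~ y).
Proof.
apply: continuous_onMc; last exact: continuous_on_cst.
by apply: continuous_on_realc => x _; exact: continuous_expR.
Qed.

Lemma continuous_on_expcis2 a b x : continuous_on a b (expcis x).
Proof.
apply: continuous_onMc; first exact: continuous_on_cst.
by move=> y _; exact: continuous_cis.
Qed.

(** Under [z = exp w] the form [K(z) dz / z] becomes [K(exp w) dw], so the integral over the angle,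
    without a factor [z], is what the rectangle theorem keeps constant. *)
Lemma circle_integral_const (K : Cplx R -> Cplx R) (r1 r2 : R) : 0 < r1 -> r1 <= r2 ->
  (forall z, r1 <= cabs z <= r2 -> derivable K z 1) ->
  cint 0 (2 * pi) (fun t => K (r1%:C * cis t)) =
  cint 0 (2 * pi) (fun t => K (r2%:C * cis t)).
Proof.
move=> r10 r12 dK; have r20 : 0 < r2 := lt_le_trans r10 r12.
have pi0 : 0 <= 2 * pi :> R by rewrite mulr_ge0// pi_ge0.
have l12 : ln r1 <= ln r2 by rewrite ler_ln.
have inr x y : ln r1 <= x <= ln r2 -> r1 <= cabs (expcis x y) <= r2.
  move=> /andP[x1 x2]; rewrite cabs_expcis.
  by rewrite -[leLHS]lnK ?posrE// ler_expR x1/= -[leRHS]lnK ?posrE// ler_expR.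
have := @goursat_rectangle R (fun x y => K (expcis x y)) (ln r1) (ln r2) 0 (2 * pi) l12 pi0.
move=> /(_ _ _ _).
(* By periodicity the sides y = 0 and y = 2 pi of the rectangle cancel. *)
have E1 : cint (ln r1) (ln r2) (fun x => K (expcis x 0) - K (expcis x (2 * pi))) = 0.
  have -> : cint (ln r1) (ln r2) (fun x => K (expcis x 0) - K (expcis x (2 * pi))) =
      cint (ln r1) (ln r2) (fun=> 0).
    by apply: eq_cint => x _; rewrite /expcis cis0 cis2pi subrr.
  by rewrite cint_cst// mulr0.
have cK a x : ln r1 <= x <= ln r2 -> {for (expcis x a), continuous K}.
  by move=> hx; apply: derivable_c_continuous; apply: dK; exact: inr.
have cy x : ln r1 <= x <= ln r2 -> continuous_on 0 (2 * pi) (fun y => K (expcis x y)).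
  by move=> hx; apply: continuous_on_comp => [y _|]; [exact: cK|exact: continuous_on_expcis2].
rewrite E1 add0r => H.
have {H} : 'i * cint 0 (2 * pi)
    (fun y => K (expcis (ln r2) y) - K (expcis (ln r1) y)) = 0 :> Cplx R.
  apply: H => //.
  - move=> y _; apply: continuous_on_comp => [x hx|]; [exact: cK|exact: continuous_on_expcis1].
  - move=> p q hp hq; pose z0 := expcis p q.
    have [c hc] := derivable_expansion (dK _ (inr p q hp)).
    (* The chain rule: half of [e] pays for the expansion of [K] at [z0], half for that of the
       exponential. [A] bounds the slope of [expcis], from its expansion with error 1, and [B]
       exceeds [|c|] so as to be nonzero. *)
    exists (c * z0) => e e0.
    pose A := cabs z0 + 1; have A0 : 0 < A by rewrite ltr_wpDl// cabs_ge0.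
    have e1 : 0 < e / (2 * A) by rewrite divr_gt0// mulr_gt0.
    pose B := cabs c + 1; have B0 : 0 < B by rewrite ltr_wpDl// cabs_ge0.
    have e2 : 0 < e / (2 * B) by rewrite divr_gt0// mulr_gt0.
    have [d d0 hd] := hc _ e1.
    have [d1 d10 hd1] := expcis_expansion p q ltr01.
    have [d2 d20 hd2] := expcis_expansion p q e2.
    exists (Num.min (Num.min d1 d2) (d / (2 * A))).
      by rewrite !lt_min d10 d20 divr_gt0// mulr_gt0.
    move=> x y; rewrite !lt_min => /andP[/andP[xd1 xd2] xd] /andP[/andP[yd1 yd2] yd].
    set h : Cplx R := (x - p) +i* (y - q).
    set n := `|x - p| + `|y - q|.
    have n0 : 0 <= n by rewrite addr_ge0.
    have hn : cabs h <= n by exact: cabs_ReIm.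
    have zn : cabs (expcis x y - z0) <= A * n.
      have -> : expcis x y - z0 = (expcis x y - z0 - z0 * h) + z0 * h by rewrite subrK.
      apply: le_trans (cabsD _ _) _; rewrite /A mulrDl addrC lerD//.
        by rewrite cabsM ler_wpM2l// cabs_ge0.
      exact: hd1.
    have zd : cabs (expcis x y - z0) < d.
      apply: le_lt_trans zn _; rewrite mulrC -ltr_pdivlMr//.
      have -> : d / A = d / (2 * A) + d / (2 * A) by field; rewrite gt_eqF.
      by rewrite ltrD.
    have -> : K (expcis x y) - K (expcis p q) - c * z0 * h =
        (K (expcis x y) - K z0 - c * (expcis x y - z0)) + c * (expcis x y - z0 - z0 * h).
      by rewrite /z0; ring.
    apply: le_trans (cabsD _ _) _.
    have -> : e * n = e / (2 * A) * (A * n) + B * (e / (2 * B) * n).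
      by field; rewrite !gt_eqF.
    apply: lerD.
      by apply: le_trans (hd _ zd) _; rewrite ler_pM2l.
    rewrite cabsM; apply: ler_pM; rewrite ?cabs_ge0//; first by rewrite lerDl.
    exact: hd2.
rewrite cintB; [|by apply: cy; rewrite lexx andbT|by apply: cy; rewrite lexx].
move=> /eqP; rewrite mulf_eq0 => /orP[|].
  by rewrite eq_complex/= oner_eq0 andbF.
by rewrite subr_eq0 /expcis !lnK ?posrE// => /eqP.
Qed.

End ExpCis.

(** * Cauchy's theorem for the difference quotient *)

Section CauchyFormula.
Variable R : realType.
Implicit Types (f K : Cplx R -> Cplx R) (w z : Cplx R).

(** The derivative is taken in the plane also at points of the unit circle, so formulas hold on the
    circle itself without a radial limit. Dilations of functions analytic in the open disk have this
    property. *)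
Definition derivable_closed_disk f := forall z, cabs z <= 1 -> derivable f z 1.

Lemma pi2_gt0 : 0 < 2 * pi :> R.
Proof. by rewrite mulr_gt0// pi_gt0. Qed.

Lemma continuous_on_circle K (r : R) : 0 <= r ->
  (forall z, cabs z = r -> {for z, continuous K}) ->
  continuous_on 0 (2 * pi) (fun t => K (r%:C * cis t)).
Proof.
move=> r0 cK.
apply: (@continuous_on_comp R 0 (2 * pi) _ _ K (fun t => r%:C * cis t)) => [t _|].
  by apply: cK; rewrite cabsM cabs_cis mulr1 cabsR ger0_norm.
apply: continuous_onMc; first exact: continuous_on_cst.
by move=> t _; exact: continuous_cis.
Qed.

(** Compactness of the segment of angles makes the continuity of [K] uniform in the angle. *)
Lemma circle_integral_continuous K (r0 : R) : 0 <= r0 <= 1 ->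
  (forall z, cabs z <= 1 -> {for z, continuous K}) ->
  forall e, 0 < e -> exists2 d, 0 < d & forall r, 0 <= r <= 1 -> `|r - r0| < d ->
  cabs (cint 0 (2 * pi) (fun t => K (r%:C * cis t)) -
        cint 0 (2 * pi) (fun t => K (r0%:C * cis t))) <= e.
Proof.
move=> /andP[r00 r01] cK e e0; have pi0 := pi2_gt0.
(* Halved, since the values at radii [r] and [r0] are both compared with the value at a fixed angle
   [t0]. *)
pose e' := e / (2 * pi) / 2; have e'0 : 0 < e' by rewrite !divr_gt0.
have near_cov : \forall r \near r0, forall t, 0 <= t <= 2 * pi ->
    cabs (K (r%:C * cis t) - K (r0%:C * cis t)) <= e / (2 * pi).
  have /compact_near_coveringP cpt := @segment_compact R 0 (2 * pi).
  have := cpt _ (nbhs r0) (fun r t =>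
    cabs (K (r%:C * cis t) - K (r0%:C * cis t)) <= e / (2 * pi)) _.
  move=> /(_ _)/(_ _)/filterS; apply.
    by move=> r hr t ht; apply: hr; rewrite /= in_itv.
  move=> t0 _.
  have z01 : cabs (r0%:C * cis t0) <= 1.
    by rewrite cabsM cabs_cis mulr1 cabsR ger0_norm.
  have /(@cvg_cabsP _ _ (nbhs _))/(_ _ e'0) KK := cK _ z01.
  have cz : (x.2%:C * cis x.1 : Cplx R) @[x --> (t0, r0)] --> (r0%:C * cis t0 : Cplx R).
    apply: (@cvgM R[i]).
      by apply: (cvg_comp _ _ cvg_snd); exact: continuous_real_complex.
    by apply: (cvg_comp _ _ cvg_fst); exact: continuous_cis.
  have cz0 : (r0%:C * cis x.1 : Cplx R) @[x --> (t0, r0)] --> (r0%:C * cis t0 : Cplx R).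
    apply: (@cvgM R[i]); first exact: cvg_cst.
    by apply: (cvg_comp _ _ cvg_fst); exact: continuous_cis.
  have K1 := cz _ KK; have K2 := cz0 _ KK.
  move: K1 K2; apply: (@filterS2 _ (filter_prod (nbhs t0) (nbhs r0))) => -[t r] /= h1 h2.
  have -> : K (r%:C * cis t) - K (r0%:C * cis t) =
    (K (r%:C * cis t) - K (r0%:C * cis t0)) - (K (r0%:C * cis t) - K (r0%:C * cis t0)).
    by rewrite opprB addrA subrK.
  apply: le_trans (cabsB _ _) _.
  by rewrite [leRHS](splitr (e / (2 * pi))) lerD.
have [d /= d0 hd] := near_cov; exists d => // r /andP[r_ge0 r_le1] rd.
have cc s : 0 <= s -> s <= 1 -> continuous_on 0 (2 * pi) (fun t => K (s%:C * cis t)).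
  by move=> s0 s1; apply: continuous_on_circle => // z zs; apply: cK; rewrite zs.
rewrite -cintB; [|exact: cc..].
have -> : e = e / (2 * pi) * (2 * pi - 0) by rewrite subr0 divfK// gt_eqF.
apply: cabs_cint_bound; first exact: ltW.
  by apply: continuous_onBc; exact: cc.
by move=> t ht; apply: hd => //; rewrite /= distrC.
Qed.

Section DifferenceQuotient.
Variables (f : Cplx R -> Cplx R) (w : Cplx R).
Hypothesis df : derivable_closed_disk f.
Hypothesis w1 : cabs w < 1.

Let q z : Cplx R := (f z - f w) / (z - w).

Let dq z : cabs z <= 1 -> z != w -> derivable q z 1.
Proof.
move=> z1 zw; apply: derivable_cM.
  by apply: derivable_cB; [exact: df|exact: derivable_c_cst].
apply: derivable_cV; first by rewrite subr_eq0.
by apply: derivable_cB; [exact: derivable_c_id|exact: derivable_c_cst].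
Qed.

(** The singularity is removed by giving the quotient the derivative of [f] as its value at [w].
    Continuity there suffices: the circle through [w] is reached as a limit of circles that avoid
    it. *)
Let continuous_extension : exists k : Cplx R -> Cplx R,
  (forall z, z != w -> k z = q z) /\
  (forall z, cabs z <= 1 -> {for z, continuous k}).
Proof.
have [c hc] := derivable_quotient (df (ltW w1)).
exists (fun z => if z == w then c else q z); split=> [z /negPf -> //|z z1].
have [zw|zw] := eqVneq z w.
  rewrite zw; apply/(@cvg_cabsP _ _ (nbhs w)) => e e0; rewrite eqxx.
  have [d d0 hd] := hc _ e0.
  have d20 : 0 < d / 2 by rewrite divr_gt0.
  have := nbhs_cabs w d20; apply: filterS => x xd.
  case: eqVneq => [_|xw]; first by rewrite subrr cabs0 ltW.
  by apply: hd => //; apply: le_lt_trans xd _; rewrite ltr_pdivrMr// ltr_pMr// ltr1n.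
have zw0 : 0 < cabs (z - w) / 2 by rewrite divr_gt0// cabs_gt0 subr_eq0.
have nw : \forall x \near z, x != w.
  have := nbhs_cabs z zw0; apply: filterS => x; apply: contraTneq => ->.
  rewrite -ltNge ltr_pdivrMr// cabsBC ltr_pMr ?ltr1n//.
  by rewrite cabs_gt0 subr_eq0 eq_sym.
have := derivable_c_continuous (dq z1 zw).
rewrite /prop_for /continuous_at (negPf zw); apply: cvg_trans.
apply: (@near_eq_cvg _ _ (nbhs z)).
by move: nw; apply: filterS => x /negPf ->.
Qed.

Lemma difference_quotient_mean0 :
  cint 0 (2 * pi) (fun t => cis t * ((f (cis t) - f w) / (cis t - w))) = 0.
Proof.
(* The circle integral I(r) of z k(z) is constant on either side of r = |w|
   and continuous on [0, 1], hence equal to I(0) = 0. *)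
have [k [kq ck]] := continuous_extension.
pose K z : Cplx R := z * k z.
have cK z : cabs z <= 1 -> {for z, continuous K}.
  by move=> z1; apply: (@cvgM R[i] _ (nbhs z)); [exact: cvg_id|exact: ck].
pose I (r : R) := cint 0 (2 * pi) (fun t => K (r%:C * cis t)).
pose rho := cabs w; have rho0 : 0 <= rho := cabs_ge0 w.
have rho1 : rho < 1 := w1.
have rcis (r t : R) : 0 <= r -> cabs (r%:C * cis t) = r.
  by move=> r0; rewrite cabsM cabs_cis mulr1 cabsR ger0_norm.
have IE (r : R) : 0 <= r -> r != rho ->
    I r = cint 0 (2 * pi) (fun t => (fun z => z * q z : Cplx R) (r%:C * cis t)).
  move=> r0 rr; apply: eq_cint => t _; rewrite /K kq//.
  by apply: contra_neq rr => /(congr1 (@cabs R)); rewrite rcis.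
(* The disjunction says that the closed annulus from [r] to [s] avoids the circle through [w], where
   [q] may fail to be differentiable. *)
have const (r s : R) : 0 < r -> r <= s -> s <= 1 -> (s < rho) || (rho < r) -> I r = I s.
  move=> r0 rs s1 sr.
  rewrite !IE; [|by lra|by case/orP: sr; lra|by lra|by case/orP: sr; lra].
  apply: (@circle_integral_const R (fun z => z * q z)) => // z /andP[rz zs].
  apply: derivable_cM; first exact: derivable_c_id.
  apply: dq; first exact: le_trans s1.
  apply: contraTneq sr => zw; move: rz zs; rewrite zw -/rho => rz zs.
  by rewrite negb_or -!leNgt zs rz.
have contI r0 : 0 <= r0 <= 1 -> forall e, 0 < e -> exists2 d, 0 < d &
    forall r, 0 <= r <= 1 -> `|r - r0| < d -> cabs (I r - I r0) <= e.
  by move=> r01; exact: circle_integral_continuous.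
have eqI (A B : Cplx R) : (forall e, 0 < e -> cabs (A - B) <= e) -> A = B.
  move=> h; apply/eqP; rewrite -subr_eq0 -cabs_eq0; apply/eqP/le_anti.
  by rewrite cabs_ge0 andbT; apply/ler_addgt0Pl => e e0; rewrite addr0; exact: h.
have I1 : I 1 = I rho.
  apply: eqI => e e0; have [|d d0 hd] := contI rho _ e e0; first by rewrite rho0 ltW.
  pose r := Num.min 1 (rho + d / 2).
  have r_rho : rho < r by rewrite lt_min w1 ltrDl divr_gt0.
  have r1 : r <= 1 by rewrite ge_min lexx.
  have rd : r <= rho + d / 2 by rewrite ge_min lexx orbT.
  rewrite -(const r 1)//; [|by lra|by rewrite r_rho orbT].
  by apply: hd; [lra|rewrite ltr_norml; lra].
have I0 : I rho = I 0.
  have [->//|rho_neq0] := eqVneq rho 0.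
  have rho_gt0 : 0 < rho by rewrite lt_def rho_neq0.
  (* [I] is constant on the open interval [(0, rho)], represented by [rho / 2], and continuous at
     both of its ends. *)
  have near0 r0 : (r0 = 0 \/ r0 = rho) -> I (rho / 2) = I r0.
    move=> hr0; have r01 : 0 <= r0 <= 1 by case: hr0 => ->; lra.
    apply: eqI => e e0; have [d d0 hd] := contI r0 r01 e e0.
    pose m := Num.min (d / 2) (rho / 2).
    have m0 : 0 < m by rewrite lt_min !divr_gt0.
    have md : m <= d / 2 by rewrite ge_min lexx.
    have mr : m <= rho / 2 by rewrite ge_min lexx orbT.
    case: hr0 => r0E.
      rewrite -(const m (rho / 2))//; [|by lra|by apply/orP; left; lra].
      by apply: hd; [lra|rewrite ltr_norml r0E; lra].
    rewrite (const (rho / 2) (rho - m))//; [|by lra|by lra|by lra|by apply/orP; left; lra].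
    by apply: hd; [lra|rewrite ltr_norml r0E; lra].
  by rewrite -(near0 rho) ?(near0 0); [|left|right].
have : I 1 = 0.
  rewrite I1 I0; have -> : I 0 = cint 0 (2 * pi) (fun=> 0).
    by apply: eq_cint => t _; rewrite /K !mul0r.
  by rewrite cint_cst ?mulr0// ltW// pi2_gt0.
rewrite IE//; last by rewrite gt_eqF.
move=> <-; apply: eq_cint => t _.
by rewrite /q mul1r.
Qed.

End DifferenceQuotient.

End CauchyFormula.

(** * Cauchy and Poisson formulas *)

Section CircleMeans.
Variable R : realType.
Implicit Types (f F G : Cplx R -> Cplx R) (g h : Cplx R -> R) (w z : Cplx R).

Definition circle_continuous (U : topologicalType) (F : Cplx R -> U) :=
  continuous_on 0 (2 * pi) (fun t => F (cis t)).

Definition cmean F : Cplx R := ((2 * pi)^-1)%:C * cint 0 (2 * pi) (fun t => F (cis t)).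

Definition rmean g : R := (2 * pi)^-1 * rint 0 (2 * pi) (fun t => g (cis t)).

Let pi2_ge0 : 0 <= 2 * pi :> R. Proof. exact: ltW (pi2_gt0 R). Qed.
Let pi2_neq0 : 2 * pi != 0 :> R. Proof. by rewrite gt_eqF ?pi2_gt0. Qed.
Let ipi_gt0 : 0 < (2 * pi)^-1 :> R. Proof. by rewrite invr_gt0 pi2_gt0. Qed.

Lemma eq_cmean F G : (forall z, cabs z = 1 -> F z = G z) -> cmean F = cmean G.
Proof. by move=> h; congr (_ * _); apply: eq_cint => t _; apply: h; exact: cabs_cis. Qed.

Lemma eq_rmean g h : (forall z, cabs z = 1 -> g z = h z) -> rmean g = rmean h.
Proof. by move=> gh; congr (_ * _); apply: eq_rint => t _; apply: gh; exact: cabs_cis. Qed.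

Lemma cmean_cst (c : Cplx R) : cmean (fun=> c) = c.
Proof.
by rewrite /cmean cint_cst// subr0 mulrA -rmorphM/= mulVf// mul1r.
Qed.

Lemma cmeanZ (c : Cplx R) F : circle_continuous F -> cmean (fun z => c * F z) = c * cmean F.
Proof. by move=> cF; rewrite /cmean (cintZ c cF) mulrCA. Qed.

Lemma cmeanB F G : circle_continuous F -> circle_continuous G ->
  cmean (fun z => F z - G z) = cmean F - cmean G.
Proof. by move=> cF cG; rewrite /cmean (cintB cF cG) mulrBr. Qed.

Lemma cmean_conj F : circle_continuous F -> cmean (fun z => (F z)^*) = (cmean F)^*.
Proof. by move=> cF; rewrite /cmean (cint_conj cF) rmorphM/= oppr0. Qed.

Lemma Re_cmean F : complex.Re (cmean F) = rmean (fun z => complex.Re (F z)).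
Proof. by rewrite /cmean /rmean -Re_cint/= mul0r subr0. Qed.

Lemma cabs_cmean_le F : circle_continuous F -> cabs (cmean F) <= rmean (fun z => cabs (F z)).
Proof.
move=> cF; rewrite /cmean cabsM cabsR ger0_norm; last exact: ltW.
by rewrite /rmean ler_pM2l//; exact: cabs_cint_le.
Qed.

Lemma le_rmean g h : circle_continuous g -> circle_continuous h ->
  (forall z, cabs z = 1 -> g z <= h z) -> rmean g <= rmean h.
Proof.
move=> cg ch gh; rewrite /rmean ler_pM2l//; apply: le_rint => // t _.
by apply: gh; exact: cabs_cis.
Qed.

Lemma rmeanD g h : circle_continuous g -> circle_continuous h ->
  rmean (fun z => g z + h z) = rmean g + rmean h.
Proof. by move=> cg ch; rewrite /rmean (rintD cg ch) mulrDr. Qed.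

Lemma rmeanZ (c : R) g : circle_continuous g -> rmean (fun z => c * g z) = c * rmean g.
Proof. by move=> cg; rewrite /rmean (rintZ c cg) mulrCA. Qed.

Lemma rmean_ge0 g : (forall z, 0 <= g z) -> 0 <= rmean g.
Proof. by move=> g0; apply: mulr_ge0; [exact: ltW|exact: Rintegral_ge0]. Qed.

Lemma circle_continuousP F : (forall z, cabs z = 1 -> {for z, continuous F}) ->
  circle_continuous F.
Proof.
move=> cF; apply: (@continuous_on_comp R 0 (2 * pi) _ _ F (@cis R)) => [t _|t _].
  by apply: cF; exact: cabs_cis.
exact: continuous_cis.
Qed.

Lemma circle_continuous_id : circle_continuous (fun z => z).
Proof. by move=> t _; exact: continuous_cis. Qed.

Lemma circle_continuous_conj F : circle_continuous F -> 
  circle_continuous (fun z => (F z)^* : Cplx R).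
Proof.
apply: (@continuous_on_comp R 0 (2 * pi) (Cplx R) (Cplx R) (@conjc R)) => t _.
exact: continuous_conj.
Qed.

Lemma derivable_circle_continuous f : derivable_closed_disk f -> circle_continuous f.
Proof.
move=> df; apply: circle_continuousP => z z1; apply: derivable_c_continuous.
by apply: df; rewrite z1.
Qed.

End CircleMeans.

(** * The Cauchy and Poisson kernels and the estimates they give *)

Section CauchyPoisson.
Variable R : realType.
Implicit Types (f : Cplx R -> Cplx R) (a b w z : Cplx R).

Lemma subr_mul_neq0 w z : cabs w < 1 -> cabs z <= 1 -> 1 - w * z != 0.
Proof.
move=> w1 z1; rewrite subr_eq0; apply: contraTneq w1 => /(congr1 (@cabs R)).
rewrite cabs1 cabsM -leNgt => E; rewrite E ler_piMr ?cabs_ge0//.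
Qed.

Let denC w z : (1 - w^* * z : Cplx R)^* = 1 - w * z^*.
Proof. by rewrite rmorphB rmorphM rmorph1/= conjcK. Qed.

Let cabs_denC w z : cabs (1 - w * z^*) = cabs (1 - w^* * z).
Proof. by rewrite -denC cabs_conj. Qed.

Let conj_neq0 w z : cabs w < 1 -> cabs z <= 1 -> 1 - w^* * z != 0.
Proof. by move=> w1 z1; apply: subr_mul_neq0; rewrite ?cabs_conj. Qed.

Let conj_neq0' w z : cabs w < 1 -> cabs z <= 1 -> 1 - w * z^* != 0.
Proof. by move=> w1 z1; apply: subr_mul_neq0; rewrite ?cabs_conj. Qed.

(** For [|z| = 1] this function is [z / (z - w)], the Cauchy kernel relative to normalised arc
    length. *)
Lemma cauchy_kernel_continuous w : cabs w < 1 ->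
  circle_continuous (fun z => (1 - w * z^*)^-1 : Cplx R).
Proof.
move=> w1; apply: continuous_onVc.
  by move=> t _; rewrite conj_neq0'// cabs_cis.
apply: continuous_onBc; first exact: continuous_on_cst.
apply: continuous_onMc; first exact: continuous_on_cst.
exact: (@circle_continuous_conj R (fun z => z) (@circle_continuous_id R)).
Qed.

(** The vanishing mean of the difference quotient is Cauchy's formula with its constant not yet
    evaluated. At [w = 0] the constant is visibly 1, which gives the mean value property; that
    property then evaluates the constant for general [w]. *)
Let cauchy0 f w : derivable_closed_disk f -> cabs w < 1 ->
  cmean (fun z => f z / (1 - w * z^*)) = f w * cmean (fun z => (1 - w * z^*)^-1).
Proof.
move=> df w1; have ck := cauchy_kernel_continuous w1.
have cf := derivable_circle_continuous df.
apply/eqP; rewrite -subr_eq0 -cmeanZ//.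
rewrite -cmeanB; last 2 first.
- exact: continuous_onMc cf ck.
- by apply: continuous_onMc; [exact: continuous_on_cst|exact: ck].
rewrite /cmean; apply/eqP.
rewrite -[RHS](mulr0 ((2 * pi)^-1%:C : Cplx R)) -(difference_quotient_mean0 df w1).
congr (_ * _); apply: eq_cint => t _.
have ct := cis_neq0 t.
have -> : cis t - w = cis t * (1 - w * (cis t)^*).
  by rewrite mulrBr mulr1 conj_cis mulrCA mulfV// mulr1.
rewrite -mulrBl invfM mulrCA; congr (_ * _).
by rewrite mulrA mulfV// mul1r.
Qed.

Lemma mean_value f : derivable_closed_disk f -> cmean f = f 0.
Proof.
move=> df; have := @cauchy0 f 0 df; rewrite cabs0 ltr01 => /(_ isT).
have E : (1 - 0 * _^*)^-1 = 1 :> Cplx R by move=> z; rewrite mul0r subr0 invr1.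
have -> : cmean (fun z => (1 - 0 * z^*)^-1) = 1.
  by rewrite -[RHS]cmean_cst; apply: eq_cmean => z _; rewrite E.
rewrite mulr1 => <-; apply: eq_cmean => z _.
by rewrite E mulr1.
Qed.

Lemma derivable_kernel w : cabs w < 1 ->
  derivable_closed_disk (fun z => (1 - w * z)^-1 : Cplx R).
Proof.
move=> w1 z z1; apply: derivable_cV; first exact: subr_mul_neq0.
apply: derivable_cB; first exact: derivable_c_cst.
by apply: derivable_cM; [exact: derivable_c_cst|exact: derivable_c_id].
Qed.

Lemma cauchy_formula f w : derivable_closed_disk f -> cabs w < 1 ->
  cmean (fun z => f z / (1 - w * z^*)) = f w.
Proof.
move=> df w1; rewrite cauchy0//.
(* On the circle the kernel is the conjugate of the analytic function [(1 - w^* * z)^-1], whose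
   value at 0 is 1. *)
suff -> : cmean (fun z => (1 - w * z^*)^-1) = 1 by rewrite mulr1.
have w1' : cabs (w^* : Cplx R) < 1 by rewrite cabs_conj.
have dk := derivable_kernel w1'.
have := mean_value dk; rewrite mulr0 subr0 invr1 => /(congr1 (@conjc R)).
rewrite rmorph1 -cmean_conj; last exact: derivable_circle_continuous.
move=> E; rewrite -[RHS]E; apply: eq_cmean => z _.
by rewrite -denC fmorphV.
Qed.

Definition poisson_kernel w z : R := (1 - cabs w ^+ 2) / cabs (1 - w^* * z) ^+ 2.

Lemma poisson_kernel_ge0 w z : cabs w < 1 -> 0 <= poisson_kernel w z.
Proof.
move=> w1; rewrite divr_ge0 ?sqr_ge0// subr_ge0.
by rewrite -(expr1n _ 2) lerXn2r ?nnegrE ?cabs_ge0// ltW.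
Qed.

Lemma disk_defect_gt0 w : cabs w < 1 -> 0 < 1 - cabs w ^+ 2.
Proof.
by move=> w1; rewrite subr_gt0 -(expr1n _ 2) ltrXn2r// ?nnegrE ?cabs_ge0.
Qed.

Lemma poisson_kernel_continuous w : cabs w < 1 -> circle_continuous (poisson_kernel w).
Proof.
move=> w1; apply: continuous_onMr; first exact: continuous_on_cst.
apply: continuous_onVr.
  by move=> t _; rewrite expf_neq0// cabs_eq0 conj_neq0// cabs_cis.
have c : continuous_on 0 (2 * pi) (fun t => cabs (1 - w^* * cis t)).
  apply: continuous_on_cabs; apply: continuous_onBc; first exact: continuous_on_cst.
  by apply: continuous_onMc; [exact: continuous_on_cst|exact: circle_continuous_id].
exact: continuous_onMr.
Qed.

(** Cauchy's formula for [f(z) / (1 - w^* z)]: the extra factor turns the Cauchy kernel into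
    [|1 - w^* z|^-2], and its value at [w] supplies the numerator [1 - |w|^2]. *)
Lemma poisson_formula f w : derivable_closed_disk f -> cabs w < 1 ->
  cmean (fun z => (poisson_kernel w z)%:C * f z) = f w.
Proof.
move=> df w1; have d0 := disk_defect_gt0 w1.
have w1' : cabs (w^* : Cplx R) < 1 by rewrite cabs_conj.
have dk : derivable_closed_disk (fun z => f z * (1 - w^* * z)^-1 : Cplx R).
  by move=> z z1; apply: derivable_cM; [exact: df|exact: derivable_kernel].
have := cauchy_formula dk w1.
rewrite [w^* * w]mulrC mulc_conj.
have D0 : (1 - (cabs w ^+ 2)%:C : Cplx R) = (1 - cabs w ^+ 2)%:C by rewrite rmorphB rmorph1.
rewrite D0 => E.
have Dn0 : (1 - cabs w ^+ 2)%:C != 0 :> Cplx R by rewrite eq_complex/= eqxx andbT gt_eqF.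
apply: (mulIf (invr_neq0 Dn0)); rewrite -E mulrC -cmeanZ.
  apply: eq_cmean => z z1.
  have -> : ((poisson_kernel w z)%:C : Cplx R) =
      (1 - cabs w ^+ 2)%:C * ((1 - w^* * z)^-1 * (1 - w * z^*)^-1).
    rewrite /poisson_kernel rmorphM/=; congr (_ * _).
    by rewrite fmorphV/= -mulc_conj denC invfM.
  by rewrite !mulrA mulVf// mul1r mulrC mulrA.
apply: continuous_onMc; last exact: derivable_circle_continuous.
by apply: continuous_on_realc; exact: poisson_kernel_continuous.
Qed.

Lemma rmean_poisson_kernel w : cabs w < 1 -> rmean (poisson_kernel w) = 1.
Proof.
move=> w1; have dc : derivable_closed_disk (fun=> 1 : Cplx R).
  by move=> z _; exact: derivable_c_cst.
have := congr1 (@complex.Re R) (poisson_formula dc w1); rewrite Re_cmean /= => <-.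
by apply: eq_rmean => z _; rewrite /= mulr1 mulr0 subr0.
Qed.

(** The harmonic majorant of [|f|^2] with the same values on the circle. *)
Definition poisson_integral f w : R := rmean (fun z => poisson_kernel w z * cabs (f z) ^+ 2).

Lemma poisson_integrand_continuous f w : circle_continuous f -> cabs w < 1 ->
  circle_continuous (fun z => poisson_kernel w z * cabs (f z) ^+ 2).
Proof.
move=> cf w1; have ca := continuous_on_cabs cf.
apply: continuous_onMr; first exact: poisson_kernel_continuous.
exact: continuous_onMr.
Qed.

(** With [A = |f(w)|], the Poisson formula gives [A <= mean of P |f|]. Integrating
    [2 A |f| <= |f|^2 + A^2] against the kernel, which has mean 1, turns this into the bound for
    squares. *)
Lemma jensen f w : derivable_closed_disk f -> cabs w < 1 ->
  cabs (f w) ^+ 2 <= poisson_integral f w.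
Proof.
move=> df w1; have cf := derivable_circle_continuous df.
have cP := poisson_kernel_continuous w1.
have cI := poisson_integrand_continuous cf w1.
have ca := continuous_on_cabs cf.
have H : cabs (f w) <= rmean (fun z => poisson_kernel w z * cabs (f z)).
  rewrite -{1}(poisson_formula df w1).
  apply: (le_trans (cabs_cmean_le _)).
    by apply: continuous_onMc; [exact: continuous_on_realc|].
  apply: le_rmean; [|exact: continuous_onMr|].
    by apply: continuous_on_cabs; apply: continuous_onMc; [exact: continuous_on_realc|].
  by move=> z _; rewrite cabsM cabsR ger0_norm// poisson_kernel_ge0.
have A0 := cabs_ge0 (f w); set A := cabs (f w) in H A0 *.
suff : 2 * A * A <= poisson_integral f w + A ^+ 2 * 1.
  by rewrite expr2; lra.
have H' : 2 * A * A <= 2 * A * rmean (fun z => poisson_kernel w z * cabs (f z)).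
  by rewrite ler_wpM2l// mulr_ge0.
apply: le_trans H' _.
have cPa : circle_continuous (fun z => poisson_kernel w z * cabs (f z)).
  exact: continuous_onMr.
have cAP : circle_continuous (fun z => A ^+ 2 * poisson_kernel w z).
  by apply: continuous_onMr => //; exact: continuous_on_cst.
have -> : A ^+ 2 * 1 = rmean (fun z => A ^+ 2 * poisson_kernel w z).
  by rewrite (rmeanZ _ cP) rmean_poisson_kernel.
rewrite /poisson_integral -(rmeanZ _ cPa) -(rmeanD cI cAP).
apply: le_rmean.
- by apply: continuous_onMr => //; exact: continuous_on_cst.
- exact: continuous_onDr.
move=> z _; have P0 := poisson_kernel_ge0 z w1.
suff : 2 * A * (poisson_kernel w z * cabs (f z)) <=
    poisson_kernel w z * cabs (f z) ^+ 2 + A ^+ 2 * poisson_kernel w z by [].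
have := mulr_ge0 P0 (sqr_ge0 (A - cabs (f z))); nra.
Qed.

Lemma poisson_integral_le f w (C : R) : circle_continuous f -> cabs w < 1 ->
  (forall t, 0 <= t <= 2 * pi -> cabs (f (cis t)) ^+ 2 <= C) -> poisson_integral f w <= C.
Proof.
move=> cf w1 fC; have cP := poisson_kernel_continuous w1.
have -> : C = rmean (fun z => C * poisson_kernel w z).
  by rewrite (rmeanZ _ cP) rmean_poisson_kernel// mulr1.
rewrite /poisson_integral /rmean ler_pM2l ?invr_gt0 ?pi2_gt0//; apply: le_rint.
- exact: poisson_integrand_continuous.
- by apply: continuous_onMr; [exact: continuous_on_cst|exact: cP].
by move=> t t1; rewrite mulrC ler_wpM2r ?poisson_kernel_ge0// fC.
Qed.

(* Cauchy-Schwarz, in the form 2xy <= l x^2 + y^2/l with the optimal l, for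
   the product f(z)/(1 - a z^* ) * 1/(1 - b z^* ). *)
Lemma difference_estimate f a b : derivable_closed_disk f -> cabs a < 1 -> cabs b < 1 ->
  cabs (f a - f b) ^+ 2 <= cabs (a - b) ^+ 2 * poisson_integral f a /
    ((1 - cabs a ^+ 2) * (1 - cabs b ^+ 2)).
Proof.
move=> df a1 b1; have cf := derivable_circle_continuous df.
have ka := cauchy_kernel_continuous a1; have kb := cauchy_kernel_continuous b1.
have a0 := disk_defect_gt0 a1; have b0 := disk_defect_gt0 b1.
(* All of [f] is grouped with the kernel at [a], so its square mean is a Poisson integral at [a]
   alone; the square mean of [Y] is explicit. *)
pose X z := cabs (f z) * (cabs (1 - a^* * z))^-1.
pose Y z := (cabs (1 - b^* * z))^-1.
have cY w : cabs w < 1 -> circle_continuous (fun z => (cabs (1 - w^* * z))^-1).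
  move=> w1; apply: continuous_onVr.
    by move=> t _; rewrite cabs_eq0 conj_neq0// cabs_cis.
  apply: continuous_on_cabs; apply: continuous_onBc; first exact: continuous_on_cst.
  by apply: continuous_onMc; [exact: continuous_on_cst|exact: circle_continuous_id].
have cYb : circle_continuous Y by exact: cY.
have cX : circle_continuous X.
  by apply: continuous_onMr; [exact: continuous_on_cabs cf|exact: cY a1].
have cXX : circle_continuous (fun z => X z ^+ 2) by exact: continuous_onMr.
have cYY : circle_continuous (fun z => Y z ^+ 2) by exact: continuous_onMr.
have cXY : circle_continuous (fun z => X z * Y z) by exact: continuous_onMr.
have mX : rmean (fun z => X z ^+ 2) = poisson_integral f a / (1 - cabs a ^+ 2).
  have cI := poisson_integrand_continuous cf a1.
  rewrite mulrC -(rmeanZ _ cI); apply: eq_rmean => z z1.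
  by rewrite /X /poisson_kernel exprMn exprVn; field; rewrite !gt_eqF// cabs_gt0 conj_neq0// z1.
have mY : rmean (fun z => Y z ^+ 2) = (1 - cabs b ^+ 2)^-1.
  have cP := poisson_kernel_continuous b1.
  have -> : (1 - cabs b ^+ 2)^-1 = rmean (fun z => (1 - cabs b ^+ 2)^-1 * poisson_kernel b z).
    by rewrite (rmeanZ _ cP) rmean_poisson_kernel// mulr1.
  apply: eq_rmean => z z1.
  by rewrite /Y /poisson_kernel exprVn; field; rewrite !gt_eqF// cabs_gt0 conj_neq0// z1.
pose T := rmean (fun z => X z * Y z).
have main : cabs (f a - f b) <= cabs (a - b) * T.
  rewrite -(cauchy_formula df a1) -(cauchy_formula df b1) -cmeanB; last 2 first.
  - exact: continuous_onMc cf ka.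
  - exact: continuous_onMc cf kb.
  apply: (le_trans (cabs_cmean_le _)).
    by apply: continuous_onBc; [exact: continuous_onMc cf ka|exact: continuous_onMc cf kb].
  rewrite -(rmeanZ _ cXY); apply: le_rmean.
  - apply: continuous_on_cabs.
    by apply: continuous_onBc; [exact: continuous_onMc cf ka|exact: continuous_onMc cf kb].
  - by apply: continuous_onMr; [exact: continuous_on_cst|].
  move=> z z1; have z1' : cabs z <= 1 by rewrite z1.
  have na := conj_neq0' a1 z1'; have nb := conj_neq0' b1 z1'.
  have -> : f z / (1 - a * z^*) - f z / (1 - b * z^*) =
      (a - b) * (f z * z^* / ((1 - a * z^*) * (1 - b * z^*))).
    by field; rewrite na nb.
  rewrite !cabsM cabsV cabsM cabs_conj z1 mulr1 !cabs_denC ler_wpM2l ?cabs_ge0//.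
  by rewrite /X /Y invfM !mulrA.
have T0 : 0 <= T by apply: rmean_ge0 => z; rewrite /X /Y !mulr_ge0 ?invr_ge0 ?cabs_ge0.
have CS : T ^+ 2 <= poisson_integral f a / (1 - cabs a ^+ 2) * (1 - cabs b ^+ 2)^-1.
  rewrite -mX -mY; set A := rmean _; set B := rmean _.
  have B0 : 0 < B by rewrite /B mY invr_gt0.
  have A0 : 0 <= A by apply: rmean_ge0 => z; exact: sqr_ge0.
  have [->|Tn0] := eqVneq T 0; first by rewrite expr0n mulr_ge0// ltW.
  have Tgt : 0 < T by rewrite lt_def Tn0.
  (* This choice makes the right-hand side [A * B / T + T], hence [T ^+ 2 <= A * B] without square
     roots. *)
  pose l := B / T; have l0 : 0 < l by rewrite divr_gt0.
  have cl : circle_continuous (fun z => l * X z ^+ 2).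
    by apply: continuous_onMr; [exact: continuous_on_cst|].
  have cl' : circle_continuous (fun z => l^-1 * Y z ^+ 2).
    by apply: continuous_onMr; [exact: continuous_on_cst|].
  have H : 2 * T <= l * A + l^-1 * B.
    rewrite /T /A /B -(rmeanZ _ cXY) -(rmeanZ _ cXX) -(rmeanZ _ cYY) -(rmeanD cl cl').
    apply: le_rmean.
    - by apply: continuous_onMr; [exact: continuous_on_cst|].
    - exact: continuous_onDr.
    move=> z _; suff : 2 * (X z * Y z) <= l * X z ^+ 2 + l^-1 * Y z ^+ 2 by [].
    have -> : l * X z ^+ 2 + l^-1 * Y z ^+ 2 = 2 * (X z * Y z) + l^-1 * (l * X z - Y z) ^+ 2.
      by field; rewrite gt_eqF.
    by rewrite lerDl mulr_ge0 ?sqr_ge0// invr_ge0 ltW.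
  have E1 : l * A = A * B / T by rewrite /l; ring.
  have E2 : l^-1 * B = T by rewrite /l; field; rewrite !gt_eqF.
  rewrite E1 E2 in H.
  rewrite expr2 -ler_pdivlMr//; lra.
have {}main : cabs (f a - f b) ^+ 2 <= (cabs (a - b) * T) ^+ 2.
  by rewrite lerXn2r ?nnegrE ?cabs_ge0// mulr_ge0 ?cabs_ge0.
apply: le_trans main _; rewrite exprMn -mulrA ler_wpM2l ?sqr_ge0//.
by rewrite invfM mulrA.
Qed.

(** The quotient is the Herglotz kernel, analytic in [w]: this is how harmonicity of the Poisson
    kernel enters. *)
Lemma poisson_kernel_Re w z : cabs w < 1 -> cabs z = 1 ->
  poisson_kernel w z = complex.Re ((1 + w * z^*) / (1 - w * z^*) : Cplx R).
Proof.
move=> w1 z1; have z1' : cabs z <= 1 by rewrite z1.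
have n0 := conj_neq0' w1 z1'.
rewrite /poisson_kernel -cabs_denC.
have -> : cabs w ^+ 2 = cabs (w * z^*) ^+ 2 by rewrite cabsM cabs_conj z1 mulr1.
move: n0; set u : Cplx R := w * z^*; move: u => u n0.
have -> : (1 + u) / (1 - u) = ((cabs (1 - u) ^+ 2)^-1)%:C * ((1 + u) * (1 - u)^*).
  have n1 : (1 - u)^* != 0 by rewrite conjc_eq0.
  rewrite fmorphV/= -mulc_conj; move: ((1 - u)^*) n1 => v n1.
  by field; rewrite n0 n1.
rewrite mulrC; case: u {n0} => x y /=; rewrite mul0r subr0; congr (_ * _).
by rewrite sqr_cabs/=; ring.
Qed.

(** The Herglotz kernel composed with [phi] is still analytic, so the real part of its mean value
    property applies. *)
Lemma poisson_kernel_mean (phi : Cplx R -> Cplx R) z : derivable_closed_disk phi ->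
  (forall y, cabs y <= 1 -> cabs (phi y) < 1) -> cabs z = 1 ->
  rmean (fun y => poisson_kernel (phi y) z) = poisson_kernel (phi 0) z.
Proof.
move=> dphi phi1 z1.
have z1' : cabs (z^* : Cplx R) <= 1 by rewrite cabs_conj z1.
pose H y : Cplx R := (1 + phi y * z^*) / (1 - phi y * z^*).
have dH : derivable_closed_disk H.
  move=> y y1.
  have dp : derivable (fun y => phi y * z^* : Cplx R) y 1.
    by apply: derivable_cM; [exact: dphi|exact: derivable_c_cst].
  apply: derivable_cM; first by apply: derivable_cD; [exact: derivable_c_cst|].
  apply: derivable_cV; last by apply: derivable_cB; [exact: derivable_c_cst|].
  by apply: subr_mul_neq0 => //; exact: phi1.
rewrite poisson_kernel_Re//; last by apply: phi1; rewrite cabs0.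
have := congr1 (@complex.Re R) (mean_value dH); rewrite Re_cmean => <-.
by apply: eq_rmean => y y1; rewrite poisson_kernel_Re// phi1// y1.
Qed.

(** The numerator is at most 1 and [|1 - w^* z| >= 1 - m]. This is cruder than Harnack's
    [(1 + m) / (1 - m)], but a perfect square. *)
Lemma poisson_kernel_le (w z : Cplx R) (m : R) : cabs w <= m -> m < 1 -> cabs z = 1 ->
  poisson_kernel w z <= ((1 - m) ^+ 2)^-1.
Proof.
move=> wm m1 z1; have w0 := cabs_ge0 w.
have NL : 1 - m <= cabs (1 - w^* * z).
  apply: (@le_trans _ _ (1 - cabs w)); first by lra.
  have -> : cabs w = cabs (w^* * z) by rewrite cabsM cabs_conj z1 mulr1.
  rewrite lerBlDr -{1}(cabs1 R).
  by apply: le_trans (cabsD _ _); rewrite subrK.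
have m10 : 0 < 1 - m by lra.
rewrite /poisson_kernel ler_pdivrMr; last by rewrite exprn_gt0// (lt_le_trans m10).
apply: (@le_trans _ _ 1); first by rewrite lerBlDr lerDl sqr_ge0.
rewrite mulrC ler_pdivlMr ?exprn_gt0// mul1r lerXn2r// nnegrE ltW//.
exact: lt_le_trans NL.
Qed.

Lemma poisson_integral_harnack (f : Cplx R -> Cplx R) (w : Cplx R) (m : R) :
  derivable_closed_disk f -> cabs w <= m -> m < 1 ->
  poisson_integral f w <= ((1 - m) ^+ 2)^-1 * rmean (fun z => cabs (f z) ^+ 2).
Proof.
move=> df wm m1; have cf := derivable_circle_continuous df.
have w1 := le_lt_trans wm m1.
have ca := continuous_on_cabs cf.
have caa : circle_continuous (fun z => cabs (f z) ^+ 2) by exact: continuous_onMr.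
rewrite -(rmeanZ _ caa); apply: le_rmean.
- exact: poisson_integrand_continuous.
- by apply: continuous_onMr; [exact: continuous_on_cst|exact: caa].
by move=> z z1; rewrite ler_wpM2r ?sqr_ge0// poisson_kernel_le.
Qed.

End CauchyPoisson.

(** * Poisson integrals along analytic maps *)

Section CircleMeasure.
Variable R : realType.
Implicit Types (f : Cplx R -> Cplx R) (g : R -> R).

(** Normalised arc length as a probability measure on the whole line of angles, so that the theorems
    of Tonelli and Fatou apply without a domain. *)
Definition circle_measure := uniform_prob (pi2_gt0 R).
Local Notation sigma := circle_measure.

Lemma circle_measureE g : measurable_fun setT g -> (forall t, 0 <= g t) ->
  (\int[sigma]_t (g t)%:E = ((2 * pi)^-1)%:E *
    \int[@lebesgue_measure R]_(t in `[0%R, (2 * pi)%R]) (g t)%:E)%E.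
Proof.
move=> mg g0; by rewrite integral_uniform ?subr0//; exact/measurable_EFinP.
Qed.

Lemma circle_measure_continuous g : continuous g -> (forall t, 0 <= g t) ->
  (\int[sigma]_t (g t)%:E)%E = ((2 * pi)^-1 * rint 0 (2 * pi) g)%:E.
Proof.
move=> cg g0; rewrite circle_measureE//; last exact: continuous_measurable_fun.
rewrite EFinM /rint /Rintegral fineK//; apply: integrable_fin_num => //.
by apply: continuous_on_integrable => t _; exact: cg.
Qed.

Lemma continuous_circle (U : topologicalType) (F : Cplx R -> U) :
  (forall z, cabs z = 1 -> {for z, continuous F}) -> continuous (fun t => F (cis t)).
Proof.
move=> cF t; apply: (@continuous_comp _ _ _ (@cis R) F); first exact: continuous_cis.
by apply: cF; exact: cabs_cis.
Qed.

Lemma continuous_circle_derivable f : derivable_closed_disk f ->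
  continuous (fun t => f (cis t)).
Proof.
move=> df; apply: continuous_circle => z z1; apply: derivable_c_continuous.
by apply: df; rewrite z1.
Qed.

(** Inversion of nonnegative reals is the power [-1], even at 0, where both give 0. *)
Lemma measurable_fun_inv (d : measure_display) (T : measurableType d) (h : T -> R) :
  measurable_fun setT h -> (forall x, 0 <= h x) -> measurable_fun setT (fun x => (h x)^-1).
Proof.
move=> mh h0; rewrite (_ : (fun x => (h x)^-1) = (fun x => (h x) `^ (-1))).
  exact: (measurableT_comp (measurable_powR (-1))).
by apply/funext => x; rewrite powR_inv1.
Qed.

Lemma continuous_cabs_comp (F : R -> Cplx R) : continuous F ->
  continuous (fun t => cabs (F t)).
Proof.
move=> cF t; apply: (@continuous_comp _ _ _ F (@cabs R)); first exact: cF.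
exact: continuous_cabs.
Qed.

Lemma continuous_sqr_cabs (F : R -> Cplx R) : continuous F ->
  continuous (fun t => cabs (F t) ^+ 2).
Proof.
by move=> cF t; apply: (@cvgM R _ (nbhs t)); exact: continuous_cabs_comp.
Qed.

Lemma continuous_poisson_kernel (w z : R -> Cplx R) : continuous w -> continuous z ->
  (forall t, cabs (w t) < 1) -> (forall t, cabs (z t) <= 1) ->
  continuous (fun t => poisson_kernel (w t) (z t)).
Proof.
move=> cw cz w1 z1 t; apply: (@cvgM R _ (nbhs t)).
  apply: (@cvgB R R^o _ (nbhs t)); first exact: cvg_cst.
  exact: continuous_sqr_cabs.
apply: cvgV.
  by rewrite expf_neq0// cabs_eq0 subr_mul_neq0// ?cabs_conj.
apply: (@continuous_sqr_cabs (fun t => 1 - (w t)^* * z t)) => {}t.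
apply: (@cvgB R[i] R[i]^o _ (nbhs t)); first exact: cvg_cst.
apply: (@cvgM R[i] _ (nbhs t)); last exact: cz.
apply: (@continuous_comp _ _ _ w (@conjc R : Cplx R -> Cplx R)); first exact: cw.
exact: continuous_conj.
Qed.

Lemma circle_measure_poisson f (w : Cplx R) : derivable_closed_disk f -> cabs w < 1 ->
  (\int[sigma]_s (poisson_kernel w (cis s) * cabs (f (cis s)) ^+ 2)%:E)%E =
  (poisson_integral f w)%:E.
Proof.
move=> df w1; rewrite circle_measure_continuous//.
  move=> s; apply: (@cvgM R _ (nbhs s)).
    apply: (@continuous_poisson_kernel (fun=> w) (@cis R)) => //.
    - by move=> t; exact: cvg_cst.
    - exact: continuous_cis.
    - by move=> t; rewrite cabs_cis.
  by apply: continuous_sqr_cabs; exact: continuous_circle_derivable.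
by move=> s; rewrite mulr_ge0 ?sqr_ge0// poisson_kernel_ge0.
Qed.

(** * Exchanging the two circle integrals *)

Section Tonelli.
Variables (f phi : Cplx R -> Cplx R).
Hypothesis df : derivable_closed_disk f.
Hypothesis dphi : derivable_closed_disk phi.
Hypothesis phi1 : forall z, cabs z <= 1 -> cabs (phi z) < 1.

Let k (ts : R * R) : R :=
  poisson_kernel (phi (cis ts.1)) (cis ts.2) * cabs (f (cis ts.2)) ^+ 2.

Let k_ge0 ts : 0 <= k ts.
Proof. by rewrite mulr_ge0 ?sqr_ge0// poisson_kernel_ge0// phi1// cabs_cis. Qed.

Let mk : measurable_fun setT k.
Proof.
have mRe : measurable_fun setT (fun t : R => complex.Re (phi (cis t))).
  apply: continuous_measurable_fun => t.
  apply: (@continuous_comp _ _ _ (fun t => phi (cis t)) (@complex.Re R)).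
    exact: continuous_circle_derivable.
  exact: continuous_Re.
have mIm : measurable_fun setT (fun t : R => complex.Im (phi (cis t))).
  apply: continuous_measurable_fun => t.
  apply: (@continuous_comp _ _ _ (fun t => phi (cis t)) (@complex.Im R)).
    exact: continuous_circle_derivable.
  exact: continuous_Im.
have mf : measurable_fun setT (fun t : R => cabs (f (cis t))).
  apply: continuous_measurable_fun => t.
  apply: (@continuous_comp _ _ _ (fun t => f (cis t)) (@cabs R)).
    exact: continuous_circle_derivable.
  exact: continuous_cabs.
have mcos : measurable_fun setT (@cos R).
  by apply: continuous_measurable_fun; exact: continuous_cos.
have msin : measurable_fun setT (@sin R).
  by apply: continuous_measurable_fun; exact: continuous_sin.
pose a (ts : R * R) := complex.Re (phi (cis ts.1)).
pose b (ts : R * R) := complex.Im (phi (cis ts.1)).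
pose c (ts : R * R) := cos ts.2.
pose d (ts : R * R) := sin ts.2.
pose e (ts : R * R) := cabs (f (cis ts.2)).
have ma : measurable_fun setT a by exact: (measurableT_comp mRe measurable_fst).
have mb : measurable_fun setT b by exact: (measurableT_comp mIm measurable_fst).
have mc : measurable_fun setT c by exact: (measurableT_comp mcos measurable_snd).
have md : measurable_fun setT d by exact: (measurableT_comp msin measurable_snd).
have me : measurable_fun setT e by exact: (measurableT_comp mf measurable_snd).
(* [u] and [v] are the real and imaginary parts of [w^* z] for [w = phi (cis ts.1)] and
   [z = cis ts.2]. They express [k] rationally through functions of a single variable, whence joint
   measurability. *)
pose u ts := a ts * c ts + b ts * d ts.
pose v ts := a ts * d ts - b ts * c ts.
have mu : measurable_fun setT u by apply: measurable_funD; exact: measurable_funM.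
have mv : measurable_fun setT v by apply: measurable_funB; exact: measurable_funM.
have -> : k = (fun ts => (1 - (a ts * a ts + b ts * b ts)) *
    ((1 - u ts) * (1 - u ts) + v ts * v ts)^-1 * (e ts * e ts)).
  apply/funext => ts; rewrite /k /poisson_kernel (sqr_cabs (phi _)) (sqr_cabs (1 - _)).
  rewrite /u /v /a /b /c /d /e; case: (phi _) => x y /=.
  by rewrite !expr2; congr (_ * _^-1 * _); ring.
apply: measurable_funM; last exact: measurable_funM.
apply: measurable_funM.
  apply: measurable_funB; first exact: measurable_cst.
  by apply: measurable_funD; exact: measurable_funM.
apply: measurable_fun_inv.
  apply: measurable_funD; last exact: measurable_funM.
  by apply: measurable_funM; apply: measurable_funB => //; exact: measurable_cst.
by move=> ts; rewrite addr_ge0// -expr2 sqr_ge0.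
Qed.

Let inner t : (\int[sigma]_s (k (t, s))%:E)%E = (poisson_integral f (phi (cis t)))%:E.
Proof.
by apply: (@circle_measure_poisson f (phi (cis t))) => //; rewrite phi1// cabs_cis.
Qed.

Let outer s : (\int[sigma]_t (k (t, s))%:E)%E =
  (poisson_kernel (phi 0) (cis s) * cabs (f (cis s)) ^+ 2)%:E.
Proof.
have cP : continuous (fun t => poisson_kernel (phi (cis t)) (cis s)).
  apply: continuous_poisson_kernel.
  - exact: continuous_circle_derivable.
  - by move=> t; exact: cvg_cst.
  - by move=> t; rewrite phi1// cabs_cis.
  - by move=> t; rewrite cabs_cis.
have ck : continuous (fun t => k (t, s)).
  by rewrite /k/= => t; apply: (@cvgM R _ (nbhs t)); [exact: cP|exact: cvg_cst].
rewrite circle_measure_continuous//.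
congr EFin; rewrite /k/= -(poisson_kernel_mean dphi phi1 (cabs_cis s)) /rmean.
rewrite -mulrA; congr (_ * _); rewrite [RHS]mulrC -rintZ; last by move=> t _; exact: cP.
by apply: eq_rint => t _; rewrite mulrC.
Qed.

Lemma measurable_poisson_integral :
  measurable_fun setT (fun t : R => poisson_integral f (phi (cis t))).
Proof.
apply/measurable_EFinP.
rewrite (_ : EFin \o _ = fubini_F sigma (EFin \o k)).
  apply: measurable_fun_fubini_tonelli_F; first exact/measurable_EFinP.
  by move=> ts; rewrite lee_fin.
by apply/funext => t; rewrite /fubini_F inner.
Qed.

(* Poisson integrals are harmonic, so they satisfy the mean value property
   along analytic maps. *)
Lemma poisson_integral_mean :
  (\int[sigma]_t (poisson_integral f (phi (cis t)))%:E)%E = (poisson_integral f (phi 0))%:E.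
Proof.
under eq_integral do rewrite -inner.
rewrite (@fubini_tonelli _ _ _ _ _ sigma sigma (EFin \o k)); last 2 first.
- exact/measurable_EFinP.
- by move=> ts; rewrite lee_fin.
under eq_integral do rewrite outer.
by rewrite circle_measure_poisson// phi1// cabs0.
Qed.

End Tonelli.

Lemma poisson_integral0 f : poisson_integral f 0 = rmean (fun z => cabs (f z) ^+ 2).
Proof.
apply: eq_rmean => z z1; rewrite /poisson_kernel cabs0 conjc0 mul0r subr0 cabs1.
by rewrite expr0n subr0 expr1n invr1 !mul1r.
Qed.

Lemma circle_mean_sqr f : derivable_closed_disk f ->
  (\int[sigma]_t (cabs (f (cis t)) ^+ 2)%:E)%E = (rmean (fun z => cabs (f z) ^+ 2))%:E.
Proof.
move=> df; rewrite circle_measure_continuous//; last by move=> t; exact: sqr_ge0.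
by apply: continuous_sqr_cabs; exact: continuous_circle_derivable.
Qed.

(** [jensen] at the points [q z] bounds the smaller mean by the mean of the Poisson integral along
    [z -> q z], which is its value at 0, the mean over the unit circle. *)
Lemma circle_mean_sqr_mono f (q : R) : derivable_closed_disk f -> 0 <= q < 1 ->
  (\int[sigma]_t (cabs (f (q%:C * cis t)) ^+ 2)%:E <=
   \int[sigma]_t (cabs (f (cis t)) ^+ 2)%:E)%E.
Proof.
move=> df /andP[q0 q1]; pose phi z : Cplx R := q%:C * z.
have dphi : derivable_closed_disk phi.
  by move=> z _; apply: derivable_cM; [exact: derivable_c_cst|exact: derivable_c_id].
have phi1 z : cabs z <= 1 -> cabs (phi z) < 1.
  move=> z1; rewrite cabsM cabsR ger0_norm//; apply: le_lt_trans q1.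
  by rewrite ler_piMr.
have dfphi : derivable_closed_disk (fun z => f (phi z)).
  move=> z z1; apply: derivable_c_comp; first exact: dphi.
  by apply: df; apply: ltW; exact: phi1.
have := poisson_integral_mean df dphi phi1.
rewrite {2}/phi mulr0 poisson_integral0 -circle_mean_sqr// => <-.
have m1 := continuous_measurable_fun (continuous_sqr_cabs (continuous_circle_derivable dfphi)).
have m2 := measurable_poisson_integral df dphi phi1.
apply: ge0_le_integral => //.
- by move=> t _; rewrite lee_fin sqr_ge0.
- by apply/measurable_EFinP; exact: m1.
- by apply/measurable_EFinP; exact: m2.
- move=> t _; rewrite lee_fin; apply: (jensen df (phi1 (cis t) _)).
  by rewrite cabs_cis.
Qed.

End CircleMeasure.

(** * Pseudo-hyperbolic geometry *)

Section Geometry.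
Variable R : realType.
Implicit Types a b w z : Cplx R.

Lemma pseudo_hyperbolicE a b : pseudo_hyperbolic a b = cabs (a - b) / cabs (1 - a^* * b).
Proof.
rewrite -[pseudo_hyperbolic a b]/(cabs ((a - b) / (1 - a^* * b))).
by rewrite cabsM cabsV.
Qed.

Lemma schwarz_pick_identity a b :
  cabs (1 - a^* * b) ^+ 2 - cabs (a - b) ^+ 2 = (1 - cabs a ^+ 2) * (1 - cabs b ^+ 2).
Proof. by rewrite !sqr_cabs; case: a b => [x y] [u v] /=; ring. Qed.

(** With [N = |1 - a^* b|], the Schwarz-Pick identity gives [(1 - delta^2) N^2 <= (1 - |a|^2)(1 -
    |b|^2)]. Either defect is at most [2 N], which cancels one factor [N] and leaves a linear bound
    for the other; finally [|a - b| <= N]. *)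
Lemma pseudo_hyperbolic_defect a b (delta : R) : cabs a < 1 -> cabs b < 1 ->
  0 <= delta < 1 -> pseudo_hyperbolic a b <= delta ->
  (1 - delta ^+ 2) / 2 * cabs (a - b) <= 1 - cabs a ^+ 2 /\
  (1 - delta ^+ 2) / 2 * cabs (a - b) <= 1 - cabs b ^+ 2.
Proof.
move=> a1 b1 /andP[d0 d1]; rewrite pseudo_hyperbolicE.
have N0 : 0 < cabs (1 - a^* * b).
  by rewrite cabs_gt0 subr_mul_neq0// ?cabs_conj// ltW.
rewrite ler_pdivrMr//.
have idN := schwarz_pick_identity a b.
have NL : 1 - cabs a * cabs b <= cabs (1 - a^* * b).
  rewrite lerBlDr -(cabs_conj a) -cabsM -{1}(cabs1 R).
  by apply: le_trans (cabsD _ _); rewrite subrK.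
move: N0 idN NL; set N := cabs (1 - _); set A := cabs a; set B := cabs b; set D := cabs (a - b).
move=> N0 idN NL DN.
have A0 : 0 <= A := cabs_ge0 a; have B0 : 0 <= B := cabs_ge0 b.
have D0 : 0 <= D := cabs_ge0 _.
have DN1 : D <= N by apply: le_trans DN _; rewrite ler_piMl// ltW.
have DD : D ^+ 2 <= delta ^+ 2 * N ^+ 2.
  by rewrite -exprMn lerXn2r// nnegrE mulr_ge0// ltW.
have NN : (1 - delta ^+ 2) * N ^+ 2 <= (1 - A ^+ 2) * (1 - B ^+ 2).
  by rewrite -idN mulrBl mul1r; lra.
have dd : 0 <= 1 - delta ^+ 2 by rewrite subr_ge0 expr_le1// ltW.
have pA : 0 < 1 - A ^+ 2 by exact: disk_defect_gt0.
have pB : 0 < 1 - B ^+ 2 by exact: disk_defect_gt0.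
(* Through [1 - A ^+ 2 <= 2 * (1 - A) <= 2 * (1 - A * B)]. *)
have bA : 1 - A ^+ 2 <= 2 * N.
  have -> : 1 - A ^+ 2 = (1 - A) * (1 + A) by ring.
  have : (1 - A) * (1 + A) <= (1 - A) * 2 by rewrite ler_wpM2l; lra.
  have : A * B <= A by rewrite ler_piMr// ltW.
  lra.
have bB : 1 - B ^+ 2 <= 2 * N.
  have -> : 1 - B ^+ 2 = (1 - B) * (1 + B) by ring.
  have : (1 - B) * (1 + B) <= (1 - B) * 2 by rewrite ler_wpM2l; lra.
  have : A * B <= B by rewrite ler_piMl// ltW.
  lra.
have fin X Y : 0 < X -> Y <= 2 * N -> (1 - delta ^+ 2) * N ^+ 2 <= X * Y ->
    (1 - delta ^+ 2) / 2 * D <= X.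
  move=> X0 Y2 H.
  have H1 : (1 - delta ^+ 2) * N ^+ 2 <= X * (2 * N).
    by apply: le_trans H _; rewrite ler_pM2l.
  have H2 : (1 - delta ^+ 2) * N <= X * 2.
    by rewrite -(ler_pM2r N0) -mulrA -expr2 -mulrA.
  have H3 : (1 - delta ^+ 2) * D <= (1 - delta ^+ 2) * N by rewrite ler_wpM2l.
  lra.
split; first exact: fin bB NN.
by apply: fin bA _ => //; rewrite [leRHS]mulrC.
Qed.

(** The triangle inequality reduces this to moduli, where the gap is exactly
    [t (1 - t) (|a| - |b|)^2]. *)
Lemma convex_defect a b (t : R) : 0 <= t <= 1 ->
  t * (1 - cabs a ^+ 2) + (1 - t) * (1 - cabs b ^+ 2) <=
  1 - cabs (t%:C * a + (1 - t)%:C * b) ^+ 2.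
Proof.
move=> /andP[t0 t1].
have H : cabs (t%:C * a + (1 - t)%:C * b) <= t * cabs a + (1 - t) * cabs b.
  apply: le_trans (cabsD _ _) _; rewrite !cabsM !cabsR !ger0_norm//; lra.
have A0 := cabs_ge0 a; have B0 := cabs_ge0 b.
have C0 := cabs_ge0 (t%:C * a + (1 - t)%:C * b : Cplx R).
have {}H : cabs (t%:C * a + (1 - t)%:C * b) ^+ 2 <= (t * cabs a + (1 - t) * cabs b) ^+ 2.
  by rewrite lerXn2r// nnegrE addr_ge0// mulr_ge0//; lra.
have : 0 <= t * (1 - t) * (cabs a - cabs b) ^+ 2.
  by rewrite mulr_ge0 ?sqr_ge0// mulr_ge0//; lra.
move: H; nra.
Qed.

Lemma convex_cabs_le a b (t m : R) : 0 <= t <= 1 -> cabs a <= m -> cabs b <= m ->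
  cabs (t%:C * a + (1 - t)%:C * b) <= m.
Proof.
move=> /andP[t0 t1] am bm; apply: le_trans (cabsD _ _) _.
rewrite !cabsM !cabsR !ger0_norm//; last by lra.
have : t * cabs a <= t * m by rewrite ler_wpM2l.
have : (1 - t) * cabs b <= (1 - t) * m by rewrite ler_wpM2l//; lra.
lra.
Qed.

Lemma convex_cabs_lt a b (t : R) : 0 <= t <= 1 -> cabs a < 1 -> cabs b < 1 ->
  cabs (t%:C * a + (1 - t)%:C * b) < 1.
Proof.
move=> t01 a1 b1; apply: (@le_lt_trans _ _ (Num.max (cabs a) (cabs b))).
  by apply: convex_cabs_le => //; rewrite le_max lexx ?orbT.
by rewrite gt_max a1.
Qed.

(* The coefficient of (s - r)^2 u in [difference_estimate] at the points of
   parameters s and r on the segment from b to a. *)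
Definition path_distortion (r s : R) a b : R :=
  cabs (a - b) ^+ 2 / ((1 - cabs (s%:C * a + (1 - s)%:C * b) ^+ 2) *
                       (1 - cabs (r%:C * a + (1 - r)%:C * b) ^+ 2)).

(** Concavity carries the two linear bounds from the endpoints to both points of the segment, so
    each factor of the denominator absorbs one factor [|a - b|], independently of [r] and [s]. *)
Lemma path_distortion_le (r s : R) a b (delta : R) : 0 <= r <= 1 -> 0 <= s <= 1 ->
  cabs a < 1 -> cabs b < 1 -> 0 <= delta < 1 -> pseudo_hyperbolic a b <= delta ->
  path_distortion r s a b <= (2 / (1 - delta ^+ 2)) ^+ 2.
Proof.
move=> r01 s01 a1 b1 d01 /(pseudo_hyperbolic_defect a1 b1 d01)[ha hb].
have dd : 0 < 1 - delta ^+ 2.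
  by case/andP: d01 => d0 d1; rewrite subr_gt0 expr_lt1.
have low t : 0 <= t <= 1 ->
    (1 - delta ^+ 2) / 2 * cabs (a - b) <= 1 - cabs (t%:C * a + (1 - t)%:C * b) ^+ 2.
  move=> t01; apply: le_trans (convex_defect _ _ t01).
  set X := _ * cabs (a - b) in ha hb *.
  have : t * X <= t * (1 - cabs a ^+ 2) by rewrite ler_wpM2l//; lra.
  have : (1 - t) * X <= (1 - t) * (1 - cabs b ^+ 2) by rewrite ler_wpM2l//; lra.
  lra.
have ps := disk_defect_gt0 (convex_cabs_lt s01 a1 b1).
have pr := disk_defect_gt0 (convex_cabs_lt r01 a1 b1).
rewrite /path_distortion ler_pdivrMr ?mulr_gt0//.
have -> : cabs (a - b) ^+ 2 = (2 / (1 - delta ^+ 2)) ^+ 2 *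
    (((1 - delta ^+ 2) / 2 * cabs (a - b)) * ((1 - delta ^+ 2) / 2 * cabs (a - b))).
  by field; rewrite gt_eqF.
have X0 : 0 <= (1 - delta ^+ 2) / 2 * cabs (a - b).
  by rewrite mulr_ge0 ?cabs_ge0// divr_ge0// ltW.
by rewrite ler_wpM2l ?sqr_ge0// ler_pM// low.
Qed.

End Geometry.

(** * Composition operators along the segment *)

Section Limits.
Variable R : realType.
Implicit Types (a b : Cplx R).

Lemma cvg_sqr_cabs (T : Type) (F : set_system T) {FF : Filter F} (u : T -> Cplx R) a :
  u x @[x --> F] --> a -> (cabs (u x) ^+ 2) @[x --> F] --> cabs a ^+ 2.
Proof.
move=> ua; have cu : cabs (u x) @[x --> F] --> cabs a.
  exact: (cvg_comp _ _ ua (@continuous_cabs R a)).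
exact: cvgM.
Qed.

Lemma cvg_convex (T : Type) (F : set_system T) {FF : Filter F} (u v : T -> Cplx R) a b (t : R) :
  u x @[x --> F] --> a -> v x @[x --> F] --> b ->
  (t%:C * u x + (1 - t)%:C * v x : Cplx R) @[x --> F] --> (t%:C * a + (1 - t)%:C * b : Cplx R).
Proof.
move=> ua vb; apply: (@cvgD R[i] R[i]^o).
  by apply: (@cvgM R[i]); [exact: cvg_cst|exact: ua].
by apply: (@cvgM R[i]); [exact: cvg_cst|exact: vb].
Qed.

Lemma cvg_path_distortion (T : Type) (F : set_system T) {FF : Filter F}
    (u v : T -> Cplx R) a b (r s : R) :
  0 <= r <= 1 -> 0 <= s <= 1 -> cabs a < 1 -> cabs b < 1 ->
  u x @[x --> F] --> a -> v x @[x --> F] --> b ->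
  path_distortion r s (u x) (v x) @[x --> F] --> path_distortion r s a b.
Proof.
move=> r01 s01 a1 b1 ua vb.
have ps := disk_defect_gt0 (convex_cabs_lt s01 a1 b1).
have pr := disk_defect_gt0 (convex_cabs_lt r01 a1 b1).
apply: cvgM.
  apply: cvg_sqr_cabs; exact: (@cvgB R[i] R[i]^o _ _ _ u v a b ua vb).
apply: cvgV; first by rewrite gt_eqF// mulr_gt0.
by apply: cvgM; (apply: (@cvgB R R^o); [exact: cvg_cst|]);
  apply: cvg_sqr_cabs; exact: cvg_convex.
Qed.

Lemma radial_cvg (f : Cplx R -> Cplx R) (zeta a : Cplx R) (x : nat -> R) :
  nontangential_limit f zeta a -> cabs zeta = 1 ->
  (forall n, 0 < x n < 1) -> x n @[n --> \oo] --> (1 : R) ->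
  f ((x n)%:C * zeta) @[n --> \oo] --> a.
Proof.
move=> fa z1 x01 x1.
(* On the radius [|z - zeta| = 1 - |z|], so it lies in every Stolz region of aperture above 1; 2 is
   one choice. *)
have M2 : 1 < 2 :> R by rewrite ltr1n.
apply: (cvg_comp (fun n => (x n)%:C * zeta : Cplx R) f _ (fa 2 M2)).
have cz : ((x n)%:C * zeta : Cplx R) @[n --> \oo] --> zeta.
  rewrite -[X in _ --> X](mul1r zeta); apply: (@cvgM R[i]); last exact: cvg_cst.
  exact: (cvg_comp _ _ x1 (@continuous_real_complex R 1)).
move=> U /cz; rewrite /= !nbhs_simpl/=; apply: filterS => n; apply.
have /andP[radius xl] := x01 n.
have cx : cabs ((x n)%:C * zeta) = x n by rewrite cabsM z1 mulr1 cabsR gtr0_norm.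
split; first by rewrite /disk/= cx.
rewrite cx -[X in _ - X](mul1r zeta) -mulrBl cabsM z1 mulr1.
have -> : ((x n)%:C - 1 : Cplx R) = (x n - 1)%:C by rewrite rmorphB rmorph1.
by rewrite cabsR ltr0_norm ?subr_lt0//; lra.
Qed.

Lemma scaled_disk (q : R) (z : Cplx R) : 0 <= q < 1 -> cabs z <= 1 -> cabs (q%:C * z) < 1.
Proof.
move=> /andP[q0 q1] z1; rewrite cabsM cabsR ger0_norm//; apply: le_lt_trans q1.
by rewrite ler_piMr.
Qed.

Lemma scaled_cis (q t : R) : 0 <= q < 1 -> cabs (q%:C * cis t) < 1.
Proof. by move=> q01; apply: scaled_disk; rewrite ?cabs_cis. Qed.

Lemma derivable_scaled (q : R) (g : Cplx R -> Cplx R) : 0 <= q < 1 ->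
  (forall z, cabs z < 1 -> derivable g z 1) ->
  derivable_closed_disk (fun z => g (q%:C * z)).
Proof.
move=> q01 dg z z1.
apply: (@derivable_c_comp R (fun z => q%:C * z) g).
  by apply: derivable_cM; [exact: derivable_c_cst|exact: derivable_c_id].
by apply: dg; exact: scaled_disk.
Qed.

End Limits.

(** * The norm estimate for the difference of composition operators *)

Section Core.
Variables (R : realType) (phi psi : Cplx R -> Cplx R) (delta : R).
Hypothesis hphi : analytic_self_map phi.
Hypothesis hpsi : analytic_self_map psi.
Hypothesis hphi_bdry : ae_circle (fun zeta =>
  exists2 a : Cplx R, nontangential_limit phi zeta a & cabs a < 1).
Hypothesis hpsi_bdry : ae_circle (fun zeta =>
  exists2 b : Cplx R, nontangential_limit psi zeta b & cabs b < 1).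
Hypothesis delta01 : 0 <= delta < 1.
Hypothesis hrho : ae_circle (fun zeta => forall a b : Cplx R,
  nontangential_limit phi zeta a -> nontangential_limit psi zeta b ->
  pseudo_hyperbolic a b <= delta).

Local Notation sigma := (@circle_measure R).
Local Notation path := (convex_path phi psi).
Let K := (2 / (1 - delta ^+ 2)) ^+ 2.

Lemma convex_path_disk (t : R) z : 0 <= t <= 1 -> cabs z < 1 -> cabs (path t z) < 1.
Proof. by move=> t01 z1; apply: convex_cabs_lt => //; [exact: hphi.2|exact: hpsi.2]. Qed.

Lemma convex_path_derivable (t : R) z : cabs z < 1 -> derivable (path t) z 1.
Proof.
move=> z1; apply: derivable_cD.
  by apply: derivable_cM; [exact: derivable_c_cst|exact: (hphi.1 z z1)].
by apply: derivable_cM; [exact: derivable_c_cst|exact: (hpsi.1 z z1)].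
Qed.

Let kappa (r s q t : R) := path_distortion r s (phi (q%:C * cis t)) (psi (q%:C * cis t)).

Let continuous_kappa (r s q : R) : 0 <= r <= 1 -> 0 <= s <= 1 -> 0 <= q < 1 ->
  continuous (kappa r s q).
Proof.
move=> r01 s01 q01 t.
have h := scaled_cis t q01.
apply: (@cvg_path_distortion R _ (nbhs t)) => //; [exact: hphi.2|exact: hpsi.2| |].
  exact: (continuous_circle_derivable (derivable_scaled q01 hphi.1)).
exact: (continuous_circle_derivable (derivable_scaled q01 hpsi.1)).
Qed.

(** Denominators start at 2 so that already the first radius is strictly larger than [r0]. *)
Let radius (r0 : R) (n : nat) := 1 - (1 - r0) / n.+2%:R.

Let radius_itv r0 n : 0 < r0 < 1 -> r0 < radius r0 n < 1.
Proof.
move=> /andP[r00 r01]; rewrite /radius.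
have n2 : 0 < n.+2%:R :> R by rewrite ltr0n.
have p : 0 < (1 - r0) / n.+2%:R by rewrite divr_gt0//; lra.
have q : (1 - r0) / n.+2%:R < 1 - r0.
  by rewrite ltr_pdivrMr// ltr_pMr ?ltr1n//; lra.
by move: p q; move: ((1 - r0) / n.+2%:R) => X p q; lra.
Qed.

Let radius_cvg r0 : radius r0 n @[n --> \oo] --> (1 : R).
Proof.
rewrite -[X in _ --> X](subr0 1) -[X in _ - X](mulr0 (1 - r0)).
apply: cvgB; first exact: cvg_cst.
apply: cvgM; first exact: cvg_cst.
have /(cvg_comp _ _ (cvg_addnr 1)) := @cvg_harmonic R.
by under eq_cvg do rewrite /= /harmonic addn1.
Qed.

Section Error.
Variables (r s C r0 : R).
Hypothesis r01 : 0 <= r <= 1.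
Hypothesis s01 : 0 <= s <= 1.
Hypothesis C0 : 0 <= C.
Hypothesis r0_itv : 0 < r0 < 1.

(* The excess of the distortion over its boundary bound K, truncated to be
   uniformly bounded. *)
Let err n t := Num.min (4 * C) ((s - r) ^+ 2 * Num.max (kappa r s (radius r0 n) t - K) 0 * C).

Let err_ge0 n t : 0 <= err n t.
Proof.
by rewrite le_min mulr_ge0//= mulr_ge0// mulr_ge0 ?sqr_ge0// le_max lexx orbT.
Qed.

Let radius_01 n : 0 <= radius r0 n < 1.
Proof. by have := radius_itv n r0_itv; have := r0_itv; lra. Qed.

Lemma measurable_err n : measurable_fun setT (err n).
Proof.
apply: measurable_minr; first exact: measurable_cst.
apply: measurable_funM; last exact: measurable_cst.
apply: measurable_funM; first exact: measurable_cst.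
apply: measurable_maxr; last exact: measurable_cst.
apply: measurable_funB; last exact: measurable_cst.
by apply: continuous_measurable_fun; exact: continuous_kappa.
Qed.

(** At almost every angle both limits [a] and [b] lie in the open disk, where the distortion is
    continuous, and its value there is at most [K]; so the positive part of the excess tends to 0.
    The [D + 1] below avoids a division by 0. *)
Let err_cvg : {ae (@lebesgue_measure R), forall t : R, 0 <= t <= 2 * pi ->
  err n t @[n --> \oo] --> (0 : R)}.
Proof.
move: hphi_bdry hpsi_bdry hrho; rewrite /ae_circle.
apply: (@filterS3 _ (almost_everywhere (@lebesgue_measure R))) => t h1 h2 h3 t2pi.
have [a pa a1] := h1 t2pi; have [b pb b1] := h2 t2pi; have dab := h3 t2pi a b pa pb.
have x01 n : 0 < radius r0 n < 1 by have := radius_itv n r0_itv; have := r0_itv; lra.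
have ca := radial_cvg pa (cabs_cis t) x01 (@radius_cvg r0).
have cb := radial_cvg pb (cabs_cis t) x01 (@radius_cvg r0).
have ck : kappa r s (radius r0 n) t @[n --> \oo] --> path_distortion r s a b.
  exact: cvg_path_distortion.
have kK := path_distortion_le r01 s01 a1 b1 delta01 dab.
apply/cvgrPdist_le => e e0.
pose D := (s - r) ^+ 2 * C; have D0 : 0 <= D by rewrite mulr_ge0 ?sqr_ge0.
have e'0 : 0 < e / (D + 1) by rewrite divr_gt0// ltr_wpDl.
move/cvgrPdist_le : ck => /(_ _ e'0); apply: filterS => n kn.
rewrite sub0r normrN ger0_norm//.
have : Num.max (kappa r s (radius r0 n) t - K) 0 <= e / (D + 1).
  rewrite ge_max (ltW e'0) andbT; move: kn; rewrite ler_norml /K /kappa.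
  set X := path_distortion r s (phi _) _; move=> /andP[kn _]; lra.
move=> H; rewrite ge_min; apply/orP; right.
have -> : (s - r) ^+ 2 * Num.max (kappa r s (radius r0 n) t - K) 0 * C =
    D * Num.max (kappa r s (radius r0 n) t - K) 0 by rewrite /D mulrAC.
apply: le_trans (ler_wpM2l D0 H) _.
rewrite mulrA ler_pdivrMr ?ltr_wpDl// mulrDr mulr1 mulrC lerDl ltW//.
Qed.

(** The exceptional set is null for Lebesgue measure, so the integral is moved to [[0, 2 pi]], where
    the cap [4 * C] is an integrable majorant. *)
Lemma err_integral_cvg : (\int[sigma]_t (err n t)%:E)%E @[n --> \oo] --> 0%E.
Proof.
have E n : (\int[sigma]_t (err n t)%:E = ((2 * pi)^-1)%:E *
    \int[@lebesgue_measure R]_(t in `[0%R, (2 * pi)%R]) (err n t)%:E)%E.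
  by apply: circle_measureE; [exact: measurable_err|exact: err_ge0].
rewrite (_ : (fun n => _) = (fun n => ((2 * pi)^-1)%:E *
    \int[@lebesgue_measure R]_(t in `[0%R, (2 * pi)%R]) (err n t)%:E)%E); last first.
  by apply/funext => n; exact: E.
rewrite -[X in _ --> X](mule0 ((2 * pi)^-1)%:E); apply: cvgeZl => //.
have [] := @dominated_convergence _ _ _ (@lebesgue_measure R)
  `[0%R, (2 * pi)%R] (measurable_itv _) (fun n t => (err n t)%:E) (fun=> 0%E) (fun=> (4 * C)%:E).
- move=> n; apply/measurable_EFinP; apply: measurable_funTS; exact: measurable_err.
- exact: measurable_cst.
- move: err_cvg; apply: (@filterS _ (almost_everywhere (@lebesgue_measure R))).
  move=> t h; rewrite /= in_itv/= => /h.
  by move=> h'; apply: cvg_EFin; [exact: nearW|exact: h'].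
- by apply: continuous_on_integrable; exact: continuous_on_cst.
- apply: aeW => t n _; rewrite lee_fin ger0_norm; last exact: err_ge0.
  by rewrite ge_min lexx.
by move=> _ _; rewrite integral0.
Qed.

End Error.

(** By convexity [|path s 0| <= m] for all [s], so one Harnack constant serves the whole segment. *)
Let m := Num.max (cabs (phi 0)) (cabs (psi 0)).

Let m1 : m < 1.
Proof.
have z1 : cabs (0 : Cplx R) < 1 by rewrite cabs0.
by rewrite gt_max; apply/andP; split; [exact: hphi.2|exact: hpsi.2].
Qed.

Section Dilated.
Variables (f : Cplx R -> Cplx R) (r s r0 : R).
Hypothesis df : derivable_closed_disk f.
Hypothesis f_mean : rmean (fun z => cabs (f z) ^+ 2) <= 1.
Hypothesis r01 : 0 <= r <= 1.
Hypothesis s01 : 0 <= s <= 1.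
Hypothesis r0_itv : 0 < r0 < 1.

Let g z : Cplx R := f (path s z) - f (path r z).

Let dg z : cabs z < 1 -> derivable g z 1.
Proof.
move=> z1; have dp (t : R) : 0 <= t <= 1 -> derivable (fun z => f (path t z)) z 1.
  move=> t01; apply: (@derivable_c_comp R (path t) f); first exact: convex_path_derivable.
  by apply: df; apply: ltW; exact: convex_path_disk.
by apply: derivable_cB; [exact: dp s01|exact: dp r01].
Qed.

(** Two bounds are available, and the minimum records the better one. Both values of [|f|^2] are at
    most [C], so the square of the difference is at most [4 * C]; otherwise the distortion is split
    into [K] and its excess, and the Poisson integral is replaced by [C] in the excess only. *)
Let pointwise (C : R) z : (forall t, 0 <= t <= 2 * pi -> cabs (f (cis t)) ^+ 2 <= C) ->
  cabs z < 1 ->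
  cabs (g z) ^+ 2 <= (s - r) ^+ 2 * K * poisson_integral f (path s z) +
    Num.min (4 * C) ((s - r) ^+ 2 *
      Num.max (path_distortion r s (phi z) (psi z) - K) 0 * C).
Proof.
move=> fC z1; have cf := derivable_circle_continuous df.
have ps := convex_path_disk s01 z1; have pr := convex_path_disk r01 z1.
have us := poisson_integral_le cf ps fC.
have Js := le_trans (jensen df ps) us.
have Jr := le_trans (jensen df pr) (poisson_integral_le cf pr fC).
have u0 : 0 <= poisson_integral f (path s z).
  exact: le_trans (sqr_ge0 _) (jensen df ps).
have D := difference_estimate df ps pr.
have E : cabs (path s z - path r z) ^+ 2 = (s - r) ^+ 2 * cabs (phi z - psi z) ^+ 2.
  have -> : path s z - path r z = (s - r)%:C * (phi z - psi z).
    by rewrite /convex_path !rmorphB rmorph1; ring.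
  by rewrite cabsM exprMn cabsR -normrX ger0_norm ?sqr_ge0.
rewrite E in D.
have {}D : cabs (g z) ^+ 2 <= (s - r) ^+ 2 *
    path_distortion r s (phi z) (psi z) * poisson_integral f (path s z).
  apply: le_trans D _; rewrite /path_distortion le_eqVlt; apply/orP; left; apply/eqP.
  by rewrite /convex_path; ring.
set u := poisson_integral f (path s z) in u0 us D *.
set k := path_distortion r s (phi z) (psi z) in D *.
have sr0 := sqr_ge0 (s - r); set L := (s - r) ^+ 2 in D sr0 *.
have K0 : 0 <= K by exact: sqr_ge0.
rewrite minEle; case: ifP => _.
  have G : cabs (g z) <= cabs (f (path s z)) + cabs (f (path r z)) := cabsB _ _.
  have g0 := cabs_ge0 (g z); set x := cabs (f _) in G Js; set y := cabs (f _) in G Jr.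
  have : cabs (g z) ^+ 2 <= (x + y) ^+ 2.
    by rewrite lerXn2r// nnegrE; apply: le_trans G.
  have : 0 <= (x - y) ^+ 2 by exact: sqr_ge0.
  have : 0 <= L * K * u by exact: mulr_ge0 (mulr_ge0 sr0 K0) u0.
  by move: Js Jr; rewrite -/x -/y; nra.
apply: le_trans D _.
have M0 : 0 <= Num.max (k - K) 0 by rewrite le_max lexx orbT.
have M1 : k - K <= Num.max (k - K) 0 by rewrite le_max lexx.
set M := Num.max _ _ in M0 M1 *.
have A1 : L * M * u <= L * M * C by rewrite ler_wpM2l// mulr_ge0.
have A2 : L * (k - K) * u <= L * M * u by rewrite ler_wpM2r// ler_wpM2l.
have -> : L * k * u = L * K * u + L * (k - K) * u by ring.
lra.
Qed.

(** The integral is estimated on a larger circle, of radius [x], chosen so that the error integral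
    is at most [e]; monotonicity of the means brings the bound back to [r0]. *)
Lemma dilated_estimate :
  (\int[sigma]_t (cabs (g (r0%:C * cis t)) ^+ 2)%:E <=
   ((s - r) ^+ 2 * K * ((1 - m) ^+ 2)^-1)%:E)%E.
Proof.
have cf : continuous (fun t => cabs (f (cis t)) ^+ 2).
  by apply: continuous_sqr_cabs; exact: continuous_circle_derivable.
have [C [C0 fC]] : exists C, 0 <= C /\
    forall t, 0 <= t <= 2 * pi -> cabs (f (cis t)) ^+ 2 <= C.
  have [||c _ hc] := @EVT_max R (fun t => cabs (f (cis t)) ^+ 2) 0 (2 * pi).
  - exact: ltW (pi2_gt0 R).
  - by apply: continuous_subspaceT.
  by exists (cabs (f (cis c)) ^+ 2); split; [exact: sqr_ge0|move=> t ht; apply: hc].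
apply/lee_addgt0Pr => e e0.
have ecv := @err_integral_cvg r s C r0 r01 s01 C0 r0_itv.
have [n hn] : exists n, (\int[sigma]_t (Num.min (4 * C) ((s - r) ^+ 2 *
    Num.max (kappa r s (radius r0 n) t - K) 0 * C))%:E <= e%:E)%E.
  move/fine_cvgP : ecv => [fn /cvgrPdist_le/(_ _ e0) cn].
  have [n [fnn cnn]] := filter_ex (filterI fn cn); exists n.
  move: cnn; rewrite sub0r normrN => /(le_trans (ler_norm _)).
  by rewrite -lee_fin /= fineK.
set x := radius r0 n in hn.
have /andP[r0x x1] : r0 < x < 1 by exact: radius_itv.
have /andP[r00 _] := r0_itv.
have x01 : 0 <= x < 1 by rewrite x1 andbT; lra.
pose gn z := g (x%:C * z).
have dgn : derivable_closed_disk gn by exact: derivable_scaled.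
have q01 : 0 <= r0 / x < 1.
  by rewrite divr_ge0//= ?ltr_pdivrMr ?mul1r//; lra.
have := circle_mean_sqr_mono dgn q01.
have -> : (fun t => (cabs (gn ((r0 / x)%:C * cis t)) ^+ 2)%:E) =
    (fun t => (cabs (g (r0%:C * cis t)) ^+ 2)%:E).
  apply/funext => t; rewrite /gn mulrA -rmorphM/= mulrCA mulfV ?mulr1// gt_eqF//; lra.
move=> H; apply: (le_trans H).
(* The mean of the Poisson integral along [A] is its value at [A 0 = path s 0], which does not
   depend on [x]. *)
pose A z := path s (x%:C * z).
have dA : derivable_closed_disk A.
  by apply: (derivable_scaled x01) => z z1; exact: convex_path_derivable.
have A1 z : cabs z <= 1 -> cabs (A z) < 1.
  by move=> z1; apply: convex_path_disk => //; exact: scaled_disk.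
have pm := poisson_integral_mean df dA A1.
have mm := measurable_poisson_integral df dA A1.
have me := @measurable_err r s C r0 r01 s01 r0_itv n.
set err := fun t : R => Num.min (4 * C) _ in me.
have err0 t : 0 <= err t.
  by rewrite le_min mulr_ge0//= mulr_ge0// mulr_ge0 ?sqr_ge0// le_max lexx orbT.
pose L := (s - r) ^+ 2 * K; have L0 : 0 <= L by rewrite mulr_ge0 ?sqr_ge0.
have u0 t : 0 <= poisson_integral f (A (cis t)).
  by apply: le_trans (sqr_ge0 _) (jensen df _); rewrite A1// cabs_cis.
have mg := continuous_measurable_fun (continuous_sqr_cabs (continuous_circle_derivable dgn)).
have mu := measurable_funM (measurable_cst L) mm.
apply: (@le_trans _ _ (\int[sigma]_t
    ((L * poisson_integral f (A (cis t)))%:E + (err t)%:E))%E).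
  apply: ge0_le_integral => //.
  - by move=> t _; rewrite lee_fin sqr_ge0.
  - by apply/measurable_EFinP; exact: mg.
  - by apply: emeasurable_funD; apply/measurable_EFinP; [exact: mu|exact: me].
  - move=> t _; rewrite -EFinD lee_fin; apply: (pointwise fC).
    exact: scaled_cis.
rewrite ge0_integralD//; last 4 first.
- by move=> t _; rewrite lee_fin mulr_ge0.
- by apply/measurable_EFinP; exact: mu.
- by move=> t _; rewrite lee_fin.
- by apply/measurable_EFinP; exact: me.
apply: leeD; last exact: hn.
under eq_integral do rewrite EFinM.
rewrite ge0_integralZl//; last 2 first.
- by apply/measurable_EFinP; exact: mm.
- by move=> t _; rewrite lee_fin.
rewrite pm -EFinM lee_fin ler_wpM2l//.
apply: le_trans (@poisson_integral_harnack R f (A 0) m df _ m1) _.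
  rewrite /A mulr0; apply: convex_cabs_le => //; rewrite le_max lexx ?orbT//.
by rewrite ler_piMr// invr_ge0 sqr_ge0.
Qed.

End Dilated.

(** The bound for the dilations of [f] retains no trace of their suprema. At fixed [r0] the points
    [path s (r0 cis t)] lie in the open disk, so the dilated integrands converge at every angle by
    continuity of [f]. *)
Lemma undilated_estimate (f : Cplx R -> Cplx R) (r s r0 : R) : analytic_on_disk f ->
  (forall q, 0 < q < 1 -> rmean (fun z => cabs (f (q%:C * z)) ^+ 2) <= 1) ->
  0 <= r <= 1 -> 0 <= s <= 1 -> 0 < r0 < 1 ->
  (\int[sigma]_t (cabs (f (path s (r0%:C * cis t)) - f (path r (r0%:C * cis t))) ^+ 2)%:E <=
   ((s - r) ^+ 2 * K * ((1 - m) ^+ 2)^-1)%:E)%E.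
Proof.
move=> df f_mean r01 s01 r0_itv.
pose hf : R := 2^-1.
have half_itv : 0 < hf < 1 by rewrite /hf invr_gt0 invf_lt1 ltr0n ?ltr1n.
pose x n := radius hf n.
have x_itv n : 0 < x n < 1 by have := radius_itv n half_itv; rewrite -/(x n); lra.
have x01 n : 0 <= x n < 1 by have := x_itv n; lra.
have dfx n : derivable_closed_disk (fun z => f ((x n)%:C * z)) by exact: derivable_scaled.
pose h n (t : R) := (cabs (f ((x n)%:C * path s (r0%:C * cis t)) -
                     f ((x n)%:C * path r (r0%:C * cis t))) ^+ 2)%:E.
have est n : (\int[sigma]_t h n t <= ((s - r) ^+ 2 * K * ((1 - m) ^+ 2)^-1)%:E)%E.
  exact: (dilated_estimate (dfx n) (f_mean _ (x_itv n)) r01 s01 r0_itv).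
have r001 : 0 <= r0 < 1 by lra.
have ccv (t v : R) : 0 <= v <= 1 -> f ((x n)%:C * path v (r0%:C * cis t)) @[n --> \oo] -->
    f (path v (r0%:C * cis t)).
  move=> v01; set w := path v _.
  have w1 : cabs w < 1 by apply: convex_path_disk => //; exact: scaled_cis.
  have cz : ((x n)%:C * w : Cplx R) @[n --> \oo] --> w.
    rewrite -[X in _ --> X](mul1r w); apply: (@cvgM R[i]); last exact: cvg_cst.
    exact: (cvg_comp _ _ (@radius_cvg hf) (@continuous_real_complex R 1)).
  exact: (cvg_comp _ _ cz (derivable_c_continuous (df w w1))).
have hcv t : h n t @[n --> \oo] -->
    (cabs (f (path s (r0%:C * cis t)) - f (path r (r0%:C * cis t))) ^+ 2)%:E.
  apply: cvg_EFin; first exact: nearW.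
  apply: cvg_sqr_cabs; apply: (@cvgB R[i] R[i]^o); exact: ccv.
have mh n : measurable_fun setT (h n).
  apply/measurable_EFinP; apply: continuous_measurable_fun; apply: continuous_sqr_cabs.
  have dd (v : R) : 0 <= v <= 1 ->
      continuous (fun t : R => f ((x n)%:C * path v (r0%:C * cis t))).
    move=> v01; apply: (@continuous_circle_derivable R
      (fun z => f ((x n)%:C * path v (r0%:C * z)))).
    apply: (derivable_scaled r001 (g := fun z => f ((x n)%:C * path v z))) => z z1.
    apply: (@derivable_c_comp R (path v) (fun z => f ((x n)%:C * z))).
      exact: convex_path_derivable.
    by apply: dfx; apply: ltW; exact: convex_path_disk.
  by move=> t; apply: (@cvgB R[i] R[i]^o _ (nbhs t)); exact: dd.
have := @fatou _ _ _ sigma setT measurableT h mh _.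
have -> : (\int[sigma]_(t in setT) limn_einf (h^~ t) =
  \int[sigma]_t (cabs (f (path s (r0%:C * cis t)) - f (path r (r0%:C * cis t))) ^+ 2)%:E)%E.
  by apply: eq_integral => t _; have [-> _] := cvg_limn_einf_sup (hcv t).
move=> /(_ _)/le_trans; apply; first by move=> n t _; rewrite lee_fin sqr_ge0.
(* The lower limit is a limit of infima over tails, each at most its first term and so at most the
   uniform bound. *)
rewrite limn_einf_lim; apply: lime_le; first exact: is_cvg_einfs.
apply: nearW => n; apply: le_trans (est n); apply: ereal_inf_lbound.
by exists n => /=.
Qed.

Lemma composition_difference_bound (r s : R) : 0 <= r -> r < s -> s <= 1 ->
  (H2_operator_norm (fun f => composition_operator (path s) f
      \- composition_operator (path r) f)%R <=
   (2 / (1 - delta ^+ 2) / (1 - m) * `|s - r|)%:E)%E.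
Proof.
move=> r_ge0 rs s_le1; have r01 : 0 <= r <= 1 by lra.
have s01 : 0 <= s <= 1 by lra.
apply: ge_ereal_sup => _ [f [[df _] f1] <-].
apply: ge_ereal_sup => ? [r0 /= + <-]; rewrite in_itv/= => r0_itv.
have mean2 (g : Cplx R -> Cplx R) q : 0 < q < 1 -> (forall z, cabs z < 1 -> derivable g z 1) ->
    integral_mean2 g q = (\int[sigma]_t (cabs (g (q%:C * cis t)) ^+ 2)%:E)%E.
  move=> q01 dg; rewrite circle_measureE//; last by move=> t; exact: sqr_ge0.
  apply: continuous_measurable_fun; apply: continuous_sqr_cabs.
  have q01' : 0 <= q < 1 by lra.
  exact: (continuous_circle_derivable (derivable_scaled q01' dg)).
(* Each circle mean is below the supremum defining [H2_norm f]; taking squares keeps the bound 1. *)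
have f_mean q : 0 < q < 1 -> rmean (fun z => cabs (f (q%:C * z)) ^+ 2) <= 1.
  move=> q01; have q01' : 0 <= q < 1 by lra.
  have M := mean2 f q q01 df.
  rewrite (circle_mean_sqr (derivable_scaled q01' df)) in M.
  have : (integral_mean2 f q `^ 2^-1 <= 1)%E.
    by apply: le_trans f1; apply: ereal_sup_ubound; exists q => //=; rewrite in_itv.
  rewrite M poweR_EFin lee_fin powR12_sqrt; last by apply: rmean_ge0 => z; exact: sqr_ge0.
  by rewrite -{1}(@sqrtr1 R) ler_sqrt.
have dd z : cabs z < 1 -> derivable (composition_operator (path s) f
      \- composition_operator (path r) f)%R z 1.
  move=> z1; have dp (t : R) : 0 <= t <= 1 -> derivable (fun z => f (path t z)) z 1.
    move=> t01; apply: (@derivable_c_comp R (path t) f); first exact: convex_path_derivable.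
    by apply: df; exact: convex_path_disk.
  by apply: derivable_cB; [exact: dp s01|exact: dp r01].
rewrite (mean2 _ r0 r0_itv dd).
have := undilated_estimate df f_mean r01 s01 r0_itv.
set I := (\int[sigma]_t _)%E => HI.
have I0 : (0 <= I)%E by apply: integral_ge0 => t _; rewrite lee_fin sqr_ge0.
suff : (I `^ 2^-1 <= (2 / (1 - delta ^+ 2) / (1 - m) * `|s - r|)%:E)%E by [].
move: I HI I0 => [x| |]//; rewrite !lee_fin => HI I0.
rewrite powR12_sqrt//.
have d0 : 0 < 1 - delta ^+ 2.
  by have /andP[? ?] := delta01; rewrite subr_gt0 expr_lt1.
have m0 : 0 < 1 - m by have := m1; lra.
have B0 : 0 <= 2 / (1 - delta ^+ 2) / (1 - m) * `|s - r|.
  by rewrite mulr_ge0// divr_ge0 ?ltW// divr_gt0.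
rewrite -(ger0_norm B0) -sqrtr_sqr ler_sqrt ?sqr_ge0//.
apply: le_trans HI _; rewrite le_eqVlt; apply/orP; left; apply/eqP.
rewrite exprMn real_normK ?num_real// /K; field.
by rewrite !gt_eqF.
Qed.

End Core.

Theorem proposition6p1 (R : realType) (phi psi : Cplx R -> Cplx R)
    (hphi : analytic_self_map phi) (hpsi : analytic_self_map psi)
    (hphi_bdry : ae_circle (fun zeta =>
       exists2 a : Cplx R, nontangential_limit phi zeta a & cabs a < 1))
    (hpsi_bdry : ae_circle (fun zeta =>
       exists2 b : Cplx R, nontangential_limit psi zeta b & cabs b < 1))
    (hrho : exists2 delta : R, delta < 1 & ae_circle (fun zeta =>
       forall a b : Cplx R,
         nontangential_limit phi zeta a -> nontangential_limit psi zeta b ->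
         pseudo_hyperbolic a b <= delta)) :
  exists B : R, forall r s : R, 0 <= r -> r < s -> s <= 1 ->
    (H2_operator_norm (fun f =>
        composition_operator (convex_path phi psi s) f
        \- composition_operator (convex_path phi psi r) f)%R
     <= (B * `|s - r|)%:E)%E.
Proof.
have [delta delta1 hdelta] := hrho.
(* [delta] may be negative, even below [-1], and the constant needs [1 - d ^+ 2 > 0]. *)
pose d := Num.max 0 delta.
have d01 : 0 <= d < 1 by rewrite le_max lexx gt_max ltr01.
have hd : ae_circle (fun zeta => forall a b : Cplx R,
    nontangential_limit phi zeta a -> nontangential_limit psi zeta b ->
    pseudo_hyperbolic a b <= d).
  move: hdelta; apply: (@filterS _ (almost_everywhere (@lebesgue_measure R))).
  move=> t h /h {}h a b ha hb; apply: le_trans (h a b ha hb) _.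
  by rewrite le_max lexx orbT.
eexists => r s r0 rs s1.
exact: (composition_difference_bound hphi hpsi hphi_bdry hpsi_bdry d01 hd).
Qed.
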